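(* The logics $\mathbf{CL}$, $\mathbf{CLM}$, $\mathbf{IL}$, $\mathbf{ILM}$, $\mathbf{ILP}$ and $\mathbf{ILW}$ are topologically strongly complete: for each such logic $L$, every set $\Gamma$ of $\mathcal{L}(\Box,\rhd)$-formulas and every formula $\varphi$, if $\Gamma\models_L^T\varphi$ then $\Gamma\vdash_L\varphi$.
   Context: The language $\mathcal{L}(\Box,\rhd)$ has countably many propositional variables, $\top,\bot$, $\neg,\land,\lor,\to$, unary $\Box,\Diamond$ ($\Diamond$ dual of $\Box$) and binary $\rhd$. $\mathbf{CL}$ is the smallest set of formulas containing all propositional tautologies, $\Box(p\to q)\to(\Box p\to\Box q)$, $\Box(\Box p\to p)\to\Box p$, J1: $\Box(p\to q)\to(p\rhd q)$; J2: $(p\rhd q)\land(q\rhd r)\to(p\rhd r)$; J3: $(p\rhd r)\land(q\rhd r)\to((p\lor q)\rhd r)$; J4: $(p\rhd q)\to(\Diamond p\to\Diamond q)$, closed under modus ponens, necessitation and substitution. A normal extension of $\mathbf{CL}$ is a superset closed under these rules; $L+\chi$ is the smallest normal extension of $L$ containing $\chi$. Axioms: J5: $\Diamond p\rhd p$; M: $(p\rhd q)\to((p\land\Box r)\rhd(q\land\Box r))$; P: $(p\rhd q)\to\Box(p\rhd q)$; W: $(p\rhd q)\to(p\rhd(q\land\Box\neg p))$. $\mathbf{CLM}=\mathbf{CL}+\mathrm{M}$, $\mathbf{IL}=\mathbf{CL}+\mathrm{J5}$, $\mathbf{ILM}=\mathbf{IL}+\mathrm{M}$, $\mathbf{ILP}=\mathbf{IL}+\mathrm{P}$,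 $\mathbf{ILW}=\mathbf{IL}+\mathrm{W}$. $\Gamma\vdash_L\varphi$ means $\bigwedge\Gamma_0\to\varphi\in L$ for some finite $\Gamma_0\subseteq\Gamma$. For a topology $\tau$ on $X$, $d_\tau(Y)=\{x: \text{every } U\in\tau \text{ containing } x \text{ meets } Y\setminus\{x\}\}$, $cd_\tau(Y)=X\setminus d_\tau(X\setminus Y)$. A bitopological space is $\langle X,\tau^0,\tau^1\rangle$, $X\ne\varnothing$, $\tau^0,\tau^1$ topologies. $e_{\tau^0,\tau^1}(Y,Z)=\{x:\forall U\in\tau^1[x\in d_{\tau^0}(Y\cap U)\Rightarrow x\in d_{\tau^0}(Z\cap U)]\}$. A valuation $v$ maps formulas to subsets of $X$, Boolean on connectives, with $v(\Box\varphi)=cd_{\tau^0}(v(\varphi))$, $v(\Diamond\varphi)=d_{\tau^0}(v(\varphi))$, $v(\varphi\rhd\psi)=e_{\tau^0,\tau^1}(v(\varphi),v(\psi))$. $\mathrm{Log}(X,\tau^0,\tau^1)$ is the set of formulas $\varphi$ with $v(\varphi)=X$ for all $v$; an $L$-space satisfies $L\subseteq\mathrm{Log}(X,\tau^0,\tau^1)$. $\Gamma\models_L^T\varphi$ means: in every $L$-space, for every valuation $v$ and point $x$, if $x\in v(\psi)$ for all $\psi\in\Gamma$ then $x\in v(\varphi)$. *)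

(* Defs.v *)
From Stdlib Require List.
From mathcomp Require Import all_boot all_classical topology.

Set Implicit Arguments.
Unset Strict Implicit.
Unset Printing Implicit Defensive.

Local Open Scope classical_set_scope.

Inductive formula : Type :=
| Var of nat
| Top
| Bot
| Not of formula
| And of formula & formula
| Or of formula & formula
| Imp of formula & formula
| Box of formula
| Rhd of formula & formula.

(* The diamond is an abbreviation, not a primitive: no axiom of CL relates it
   to the box, so its being dual to the box has to hold by definition. *)
Definition Dia (a : formula) : formula := Not (Box (Not a)).

Declare Scope formula_scope.
Delimit Scope formula_scope with F.
Bind Scope formula_scope with formula.

Notation "⊤" := Top : formula_scope.
Notation "⊥" := Bot : formula_scope.
Notation "~~ a" := (Not a) : formula_scope.
Notation "a && b" := (And a b) : formula_scope.
Notation "a || b" := (Or a b) : formula_scope.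
Notation "a ==> b" := (Imp a b) : formula_scope.
Notation "□ a" := (Box a) (at level 35, right associativity) : formula_scope.
Notation "◇ a" := (Dia a) (at level 35, right associativity) : formula_scope.
Notation "a ▷ b" := (Rhd a b) (at level 52, left associativity) : formula_scope.

(* Variables and modal formulas are the propositional atoms, with truth values
   given by [w]. *)
Fixpoint beval (w : formula -> bool) (a : formula) : bool :=
  match a with
  | Top => true
  | Bot => false
  | Not b => (~~ beval w b)%B
  | And b c => (beval w b && beval w c)%B
  | Or b c => (beval w b || beval w c)%B
  | Imp b c => (beval w b ==> beval w c)%B
  | Var _ | Box _ | Rhd _ _ => w a
  end.

Definition tautology : set formula := [set a | forall w, beval w a].

Fixpoint subst (s : nat -> formula) (a : formula) : formula :=
  match a with
  | Var n => s n
  | Top => Top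
  | Bot => Bot
  | Not b => Not (subst s b)
  | And b c => And (subst s b) (subst s c)
  | Or b c => Or (subst s b) (subst s c)
  | Imp b c => Imp (subst s b) (subst s c)
  | Box b => Box (subst s b)
  | Rhd b c => Rhd (subst s b) (subst s c)
  end.

Definition closed_under_rules (L : set formula) : Prop :=
  [/\ forall a b, L (a ==> b)%F -> L a -> L b,
      forall a, L a -> L (□ a)%F &
      forall s a, L a -> L (subst s a)].

Section Schemes.

Local Open Scope formula_scope.

Let p := Var 0.
Let q := Var 1.
Let r := Var 2.

Definition axK : formula := □ (p ==> q) ==> (□ p ==> □ q).
Definition axL : formula := □ (□ p ==> p) ==> □ p.
Definition axJ1 : formula := □ (p ==> q) ==> (p ▷ q).
Definition axJ2 : formula := (p ▷ q) && (q ▷ r) ==> (p ▷ r).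
Definition axJ3 : formula := (p ▷ r) && (q ▷ r) ==> ((p || q) ▷ r).
Definition axJ4 : formula := (p ▷ q) ==> (◇ p ==> ◇ q).
Definition axJ5 : formula := ◇ p ▷ p.
Definition axM : formula := (p ▷ q) ==> ((p && □ r) ▷ (q && □ r)).
Definition axP : formula := (p ▷ q) ==> □ (p ▷ q).
Definition axW : formula := (p ▷ q) ==> (p ▷ (q && □ ~~ p)).

End Schemes.

Definition CL : set formula :=
  smallest closed_under_rules
    (tautology `|` [set axK; axL; axJ1; axJ2; axJ3; axJ4]).

Definition extend (L : set formula) (chi : formula) : set formula :=
  smallest closed_under_rules (L `|` [set chi]).

Definition CLM : set formula := extend CL axM.
Definition IL : set formula := extend CL axJ5.
Definition ILM : set formula := extend IL axM.
Definition ILP : set formula := extend IL axP.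
Definition ILW : set formula := extend IL axW.

Definition conj (s : seq formula) : formula := foldr And Top s.

Definition derives (L Gamma : set formula) (a : formula) : Prop :=
  exists s : seq formula, List.Forall Gamma s /\ L (conj s ==> a)%F.

(* A topology on [X] is a [Topological] class on [X]. The class also packs a
   choice operator and a decidable equality on [X]; classically every type has
   both, so they put no restriction on [X], and the notions below do not depend
   on which ones the class carries. *)
Record bitopSpace : Type := BitopSpace {
  carrier :> Type;
  tau0 : Topological.axioms_ carrier;
  tau1 : Topological.axioms_ carrier;
  carrier_nonempty : [set: carrier] !=set0 }.

Section Operators.

Variable X : Type.

Definition is_open (tau : Topological.axioms_ X) (U : set X) : Prop :=
  @open (Topological.Pack tau) U.

Definition d (tau : Topological.axioms_ X) (Y : set X) : set X :=
  @limit_point (Topological.Pack tau) Y.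

Definition cd (tau : Topological.axioms_ X) (Y : set X) : set X :=
  ~` d tau (~` Y).

Definition e (t0 t1 : Topological.axioms_ X) (Y Z : set X) : set X :=
  [set x | forall U, is_open t1 U -> d t0 (Y `&` U) x -> d t0 (Z `&` U) x].

Lemma dE (tau : Topological.axioms_ X) (Y : set X) :
  d tau Y =
  [set x | forall U, is_open tau U -> U x -> U `&` (Y `\ x) !=set0].
Proof.
apply/seteqP; split=> x /=.
- move=> dx U oU Ux.
  have [|y [/eqP yx Yy Uy]] := dx U; last by exists y.
  by apply: (@open_nbhs_nbhs (Topological.Pack tau)); split.
- move=> dx U; rewrite nbhsE => -[V [oV Vx] VU].
  have [y [Vy [Yy yx]]] := dx V oV Vx.
  by exists y; split=> //; [apply/eqP | exact: VU].
Qed.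

End Operators.

Fixpoint eval (X : bitopSpace) (v : nat -> set X) (a : formula) : set X :=
  match a with
  | Var n => v n
  | Top => setT
  | Bot => set0
  | Not b => ~` eval v b
  | And b c => eval v b `&` eval v c
  | Or b c => eval v b `|` eval v c
  | Imp b c => ~` eval v b `|` eval v c
  | Box b => cd (tau0 X) (eval v b)
  | Rhd b c => e (tau0 X) (tau1 X) (eval v b) (eval v c)
  end.

Lemma eval_Dia (X : bitopSpace) (v : nat -> set X) (a : formula) :
  eval v (◇ a)%F = d (tau0 X) (eval v a).
Proof. by rewrite /= /cd !setCK. Qed.

Definition Log (X : bitopSpace) : set formula :=
  [set a | forall v : nat -> set X, eval v a = setT].

Definition is_space_of (L : set formula) (X : bitopSpace) : Prop :=
  L `<=` Log X.

Definition entails (L Gamma : set formula) (a : formula) : Prop :=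
  forall X : bitopSpace, is_space_of L X ->
  forall (v : nat -> set X) (x : X),
    (forall b, Gamma b -> eval v b x) -> eval v a x.

Definition topologically_strongly_complete (L : set formula) : Prop :=
  forall (Gamma : set formula) (a : formula),
    entails L Gamma a -> derives L Gamma a.

(* Main.v *)
(* By the ultrabouquet construction it suffices to refute every underivable formula at the root
   of a Kripke frame (R, S) for [L], where [x |= a ▷ b] means: every R-successor of [x] with
   [a] has an S-successor with [b] that is also an R-successor of [x]. Gluing such pointed frames
   below one new point, whose tau0-neighbourhoods contain the successors of almost all the
   roots for an ultrafilter, gives an [L]-space in which the new point satisfies exactly what
   almost all the roots satisfy.

   The frames consist of histories over the maximal consistent sets. A history records, besides
   its last world, from which histories it is a successor and a link, and labels which confine
   later links: a label consists of worlds that avoid the formula [b] of some refuted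
   [a ▷ b]. For ILW a label also counts how often it was narrowed, which bounds the links.
   Finite depth comes from new boxes: with J5, a Löb-minimal critical successor satisfies a
   box [□ ~~ a] that its predecessor does not.

   Without J5, critical successors need not have new boxes, so they are replaced by worlds that
   agree with them on the subformulas. For CLM these worlds have to keep the boxes of the worlds
   that link to them; they are theories of virtual roots whose boxes are generated by those of
   the replaced world and [□ o], where [o] says that some type reachable among the critical
   successors is excluded from now on. *)
From HB Require Import structures.
Require Import Defs.
From mathcomp Require Import all_boot all_classical topology.

Set Implicit Arguments.
Unset Strict Implicit.
Unset Printing Implicit Defensive.

Local Open Scope classical_set_scope.

HB.instance Definition _ := gen_eqMixin formula.

(** * Maximal consistent sets *)

Record normal (L : set formula) : Prop := Normal {
  nmp : forall a b, L (a ==> b)%F -> L a -> L b;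
  nnec : forall a, L a -> L (□ a)%F;
  nsub : forall s a, L a -> L (subst s a);
  ntaut : tautology `<=` L;
  nax : [set axK; axL; axJ1; axJ2; axJ3; axJ4] `<=` L }.

Definition sub3 (a b c : formula) (n : nat) : formula :=
  match n with 0 => a | 1 => b | _ => c end.

Section Worlds.

Variable L : set formula.

Definition theory (T : set formula) : Prop :=
  [/\ L `<=` T, forall a b, T (a ==> b)%F -> T a -> T b & ~ T ⊥%F].

Record mcs : Type := Mcs {
  wset :> formula -> Prop;
  wtheory : theory wset;
  wfull : forall a, wset a \/ wset (~~ a)%F }.

Hypothesis nL : normal L.

Lemma taut a : (forall w, beval w a) -> L a.
Proof. by move=> h; apply: (ntaut nL). Qed.

Lemma lindenbaum (T : set formula) : theory T -> exists x : mcs, T `<=` wset x.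
Proof.
move=> thT.
(* Members are joined with [T], so that the union of the empty chain also qualifies. *)
pose P := [set Y : set formula | theory (T `|` Y)].
have [F FP totF|A [PA maxA]] := @Zorn_bigcup formula P.
  have [->|/set0P[Y0 FY0]] := eqVneq F set0; first by rewrite bigcup_set0 /P /= setU0.
  case: (FP _ FY0) => LT _ _.
  have cov a : (T `|` \bigcup_(Y in F) Y) a -> exists2 Y, F Y & (T `|` Y) a.
    by case=> [Ta|[Y FY Ya]]; [exists Y0 => //; left|exists Y => //; right].
  split.
  - by move=> a La; case: (LT _ La) => [Ta|Ya]; [left|right; exists Y0].
  - move=> a b /cov[Y1 FY1 Y1ab] /cov[Y2 FY2 Y2a].
    have [Y [FY Yab Ya]] : exists Y, [/\ F Y, (T `|` Y) (a ==> b)%F & (T `|` Y) a].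
      case: (totF _ _ FY1 FY2) => sub12; [exists Y2|exists Y1]; split=> //.
        by case: Y1ab => [|/sub12]; [left|right].
      by case: Y2a => [|/sub12]; [left|right].
    case: (FP _ FY) => _ mpY _.
    by case: (mpY _ _ Yab Ya) => [Tb|Yb]; [left|right; exists Y].
  - by move=> /cov[Y FY Yb]; case: (FP _ FY).
have full a : (T `|` A) a \/ (T `|` A) (~~ a)%F.
  have [|nTa] := pselect ((T `|` A) a); [by left|right].
  case: PA => LT mpT conT.
  (* [B] is what follows once [a] is added. It can fail to be a theory only by containing [⊥], that
     is, if [~~ a] is already present. *)
  pose B := [set b | (T `|` A) (a ==> b)%F].
  have AB : (T `|` A) `<=` B.
    move=> b Tb; apply: mpT Tb; apply/LT/taut => w /=.
    by case: (beval w a) (beval w b) => [] [].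
  have Ba : B a by apply/LT/taut => w /=; case: (beval w a).
  have TB : T `|` B = B.
    by apply/seteqP; split=> b; [case=> // Tb; apply: AB; left|right].
  have AltB : A `<` B.
    split; last by move=> /(_ _ Ba) Aa; apply: nTa; right.
    by move=> b Ab; apply: AB; right.
  apply: contrapT => nna; apply: (maxA _ AltB); rewrite /P /= TB; split.
  - by move=> b Lb; apply/AB/LT.
  - move=> b c Bbc Bb; apply: (mpT) (Bb); apply: (mpT) Bbc; apply/LT/taut => w /=.
    by case: (beval w a) (beval w b) (beval w c) => [] [] [].
  - move=> Bbot; apply: nna; apply: mpT Bbot; apply/LT/taut => w /=.
    by case: (beval w a).
by exists (Mcs PA full) => a Ta; left.
Qed.

Section Booleans.
Variable x : mcs.

Lemma wL a : L a -> x a. Proof. by case: (wtheory x) => + _ _; apply. Qed.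

Lemma wmp a b : x (a ==> b)%F -> x a -> x b.
Proof. by case: (wtheory x) => _ + _; apply. Qed.

Lemma wBot : ~ x ⊥%F. Proof. by case: (wtheory x). Qed.

Lemma wNot a : x (~~ a)%F <-> ~ x a.
Proof.
split=> [xNa xa|nxa]; last by case: (wfull x a).
apply: wBot; apply: wmp xa; apply: wmp xNa; apply/wL/taut => w /=.
by case: (beval w a).
Qed.

Lemma wImp a b : x (a ==> b)%F <-> (x a -> x b).
Proof.
split=> [/wmp|h]//; have [xa|/wNot xNa] := pselect (x a).
  by apply: wmp (h xa); apply/wL/taut => w /=; case: (beval w a) (beval w b) => [] [].
by apply: wmp xNa; apply/wL/taut => w /=; case: (beval w a) (beval w b) => [] [].
Qed.

Lemma wAnd a b : x (a && b)%F <-> x a /\ x b.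
Proof.
have h1 : x ((a && b) ==> a)%F by apply/wL/taut => w /=; case: (beval w a) (beval w b) => [] [].
have h2 : x ((a && b) ==> b)%F by apply/wL/taut => w /=; case: (beval w a) (beval w b) => [] [].
have h3 : x (a ==> (b ==> (a && b)))%F
  by apply/wL/taut => w /=; case: (beval w a) (beval w b) => [] [].
split=> [xab|[xa xb]]; first by split; [apply: wmp xab|apply: wmp xab].
by apply: wmp xb; apply: wmp xa.
Qed.

Lemma wOr a b : x (a || b)%F <-> x a \/ x b.
Proof.
have h : x ((a || b) ==> (~~ a ==> b))%F
  by apply/wL/taut => w /=; case: (beval w a) (beval w b) => [] [].
split=> [xab|[xa|xb]].
- by have [|/wNot xNa] := pselect (x a); [left|right; apply: wmp xNa; apply: wmp xab].
- by apply: wmp xa; apply/wL/taut => w /=; case: (beval w a) (beval w b) => [] [].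
- by apply: wmp xb; apply/wL/taut => w /=; case: (beval w a) (beval w b) => [] [].
Qed.

Lemma wTop : x ⊤%F. Proof. exact/wL/taut. Qed.

End Booleans.

(** By directedness the consequences of single members of [Th] are closed under modus ponens, so
    consistency can be checked one member at a time. *)
Lemma extend_directed (Th : set formula) :
  Th !=set0 ->
  (forall a b, Th a -> Th b -> exists c, [/\ Th c, L (c ==> a)%F & L (c ==> b)%F]) ->
  (forall a, Th a -> ~ L (~~ a)%F) -> exists x : mcs, Th `<=` wset x.
Proof.
move=> [a0 Ta0] dir con.
pose T := [set a | exists2 c, Th c & L (c ==> a)%F].
have tr a b c : L (a ==> b)%F -> L (b ==> c)%F -> L (a ==> c)%F.
  move=> ab bc; apply: (nmp nL) bc; apply: (nmp nL) ab; apply/taut => w /=.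
  by case: (beval w a) (beval w b) (beval w c) => [] [] [].
have [x Tx] : exists x : mcs, T `<=` wset x.
  apply: lindenbaum; split.
  - move=> a La; exists a0 => //; apply: (nmp nL) La; apply/taut => w /=.
    by case: (beval w a) (beval w a0) => [] [].
  - move=> a b [c Tc cab] [e Te ea]; have [f [Tf fc fe]] := dir _ _ Tc Te.
    exists f => //; apply: (nmp nL) (tr _ _ _ fe ea).
    apply: (nmp nL) (tr _ _ _ fc cab); apply/taut => w /=.
    by case: (beval w a) (beval w b) (beval w f) => [] [] [].
  - move=> [c Tc cb]; apply: con Tc _; apply: (nmp nL) cb; apply/taut => w /=.
    by case: (beval w c).
exists x => a Ta; apply: Tx; exists a => //; apply/taut => w /=.
by case: (beval w a).
Qed.

Lemma worldsP a : (forall x : mcs, x a) -> L a.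
Proof.
move=> h; apply: contrapT => nLa.
have [||b ->|x xNa] := @extend_directed [set (~~ a)%F].
- by exists (~~ a)%F.
- by move=> b c -> ->; exists (~~ a)%F; split=> //; apply/taut => w /=; case: (beval w a).
- move=> LNNa; apply: nLa; apply: (nmp nL) LNNa; apply/taut => w /=.
  by case: (beval w a).
- by have /wNot := xNa _ erefl; apply.
Qed.

Lemma ax3 (chi a b c : formula) : L chi -> L (subst (sub3 a b c) chi).
Proof. exact: (nsub nL). Qed.

(** * Modal reasoning in maximal consistent sets and critical successors *)

Definition prec (x y : mcs) := forall a, x (□ a)%F -> y a.
Definition incl (x y : mcs) := forall a, x (□ a)%F -> y (□ a)%F.

Lemma wK (x : mcs) a b : x (□ (a ==> b))%F -> x (□ a)%F -> x (□ b)%F.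
Proof.
have /(@ax3 _ a b a)/= /(wL x) : L axK by apply: (nax nL); do 5 left.
by move=> /wImp h /h /wImp.
Qed.

Lemma wNec (x : mcs) a : L a -> x (□ a)%F.
Proof. by move=> La; apply/wL/(nnec nL). Qed.

Lemma box_mono (x : mcs) a b : (forall y : mcs, y a -> y b) -> x (□ a)%F -> x (□ b)%F.
Proof. by move=> h; apply: wK; apply/wNec/worldsP => y; apply/wImp/h. Qed.

Lemma box_and (x : mcs) a b : x (□ a)%F -> x (□ b)%F -> x (□ (a && b))%F.
Proof.
move=> xa; apply: wK; apply: box_mono xa => y ya; apply/wImp => yb.
exact/wAnd.
Qed.

(** For the converse, the formulas [f && ~~ a] with [□ f] in [x] are directed; were one of them
    refutable, [f] would imply [a], and [□ a] would follow. *)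
Lemma boxP (x : mcs) a : x (□ a)%F <-> forall y, prec x y -> y a.
Proof.
split=> [xa y|h]; first exact.
apply: contrapT => nxa.
have [||_ [f xf <-]|y hy] := @extend_directed [set (f && ~~ a)%F | f in [set f | x (□ f)%F]].
- by exists (⊤ && ~~ a)%F; exists ⊤%F => //=; apply/wNec/taut.
- move=> _ _ [f xf <-] [g xg <-]; exists ((f && g) && ~~ a)%F; split.
  + by exists (f && g)%F => //=; apply: box_and.
  + by apply/worldsP => y; apply/wImp => /wAnd[/wAnd[? ?] ?]; apply/wAnd.
  + by apply/worldsP => y; apply/wImp => /wAnd[/wAnd[? ?] ?]; apply/wAnd.
- move=> h'; apply: nxa; apply: box_mono xf => y yf.
  have /wNot := wL y h'; rewrite wAnd => ny; apply: contrapT => /wNot ya.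
  exact: ny.
have xy : prec x y by move=> f xf; have /wAnd[] := hy _ (ex_intro2 _ _ f xf erefl).
have /wAnd[_ /wNot] := hy _ (ex_intro2 _ _ ⊤%F (wNec x (@taut Top (fun=> isT))) erefl).
by apply; apply: h.
Qed.

Lemma wLoeb (x : mcs) a : x (□ (□ a ==> a))%F -> x (□ a)%F.
Proof.
have /(@ax3 _ a a a)/= /(wL x)/wImp// : L axL by apply: (nax nL); do 4 left; right.
Qed.

(** Löb's scheme applied to [a && □ a] yields transitivity. *)
Lemma box4 (x : mcs) a : x (□ a)%F -> x (□ □ a)%F.
Proof.
move=> xa; have : x (□ (a && □ a))%F.
  apply: wLoeb; apply/boxP => y xy; apply/wImp => yb; apply/wAnd; split; first exact: xy.
  by apply: box_mono yb => z /wAnd[].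
by apply: box_mono => y /wAnd[].
Qed.

Lemma prec_incl x y : prec x y -> incl x y.
Proof. by move=> xy a /box4/xy. Qed.

Lemma incl_prec x y z : incl x y -> prec y z -> prec x z.
Proof. by move=> xy yz a /xy/yz. Qed.

Lemma prec_trans x y z : prec x y -> prec y z -> prec x z.
Proof. by move=> /prec_incl; apply: incl_prec. Qed.

Lemma incl_trans x y z : incl x y -> incl y z -> incl x z.
Proof. by move=> xy yz a /xy/yz. Qed.

Lemma loeb_world (x y : mcs) a : prec x y -> y a ->
  exists z : mcs, [/\ prec x z, z a & z (□ ~~ a)%F].
Proof.
move=> xy ya; apply: contrapT => h.
suff /xy/wNot : x (□ ~~ a)%F by apply.
apply: wLoeb; apply/boxP => z xz; apply/wImp => zN; apply/wNot => za.
by apply: h; exists z.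
Qed.

Lemma rhd_box (x : mcs) a b : (forall y, prec x y -> y a -> y b) -> x (a ▷ b)%F.
Proof.
move=> h; have /(@ax3 _ a b a)/= /(wL x)/wImp : L axJ1 by apply: (nax nL); do 3 left; right.
by apply; apply/boxP => y xy; apply/wImp/h.
Qed.

Lemma rhd_trans (x : mcs) a b c : x (a ▷ b)%F -> x (b ▷ c)%F -> x (a ▷ c)%F.
Proof.
move=> ab bc; have /(@ax3 _ a b c)/= /(wL x)/wImp : L axJ2 by apply: (nax nL); do 2 left; right.
by apply; apply/wAnd.
Qed.

Lemma rhd_or (x : mcs) a b c : x (a ▷ c)%F -> x (b ▷ c)%F -> x ((a || b) ▷ c)%F.
Proof.
move=> ab bc; have /(@ax3 _ a b c)/= /(wL x)/wImp : L axJ3 by apply: (nax nL); left; right.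
by apply; apply/wAnd.
Qed.

Lemma rhd_dia (x y : mcs) a b : x (a ▷ b)%F -> prec x y -> y a ->
  exists2 z : mcs, prec x z & z b.
Proof.
move=> ab xy ya; have /(@ax3 _ a b a)/= /(wL x)/wImp/(_ ab)/wImp h : L axJ4
  by apply: (nax nL); right.
apply: contrapT => nz; suff /wNot : x (◇ b)%F.
  by apply; apply/boxP => z xz; apply/wNot => zb; apply: nz; exists z.
by apply: h; apply/wNot => /xy/wNot; apply.
Qed.

(** By J1 and J4, boxes are the case [⊥] of [▷]; accessibility is thus criticality for [⊥]. *)
Lemma rhd_bot (x : mcs) a : x (a ▷ ⊥)%F <-> x (□ ~~ a)%F.
Proof.
split=> [ab|xN]; last by apply: rhd_box => y /(_ _ xN)/wNot.
by apply/boxP => y xy; apply/wNot => ya; have [z _ /wBot] := rhd_dia ab xy ya.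
Qed.

(** The critical successors of de Jongh and Veltman without their clause on [□ ~~ e], which J5
    restores in [crit_up]. *)
Definition crit (p : mcs) d (x : mcs) := forall e, p (e ▷ d)%F -> ~ x e.

(** A box [□ a] in [p] makes [~~ a ▷ d] hold vacuously. *)
Lemma crit_prec p d x : crit p d x -> prec p x.
Proof.
move=> c a pa; apply: contrapT => /wNot xNa; apply: c xNa.
by apply: rhd_box => y /(_ _ pa) ya /wNot.
Qed.

Lemma crit_self p d x : crit p d x -> ~ x d.
Proof. by apply; apply: rhd_box. Qed.

Lemma crit_bot p x : crit p ⊥%F x <-> prec p x.
Proof.
by split=> [/crit_prec//|px e /rhd_bot/px/wNot].
Qed.

(* Compactness for critical successors: [J3] makes the formulas to be avoided closed under
   disjunction. *)
Lemma crit_extend (p : mcs) d (Ps : set formula) :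
  Ps !=set0 ->
  (forall a b, Ps a -> Ps b -> exists c, [/\ Ps c, L (c ==> a)%F & L (c ==> b)%F]) ->
  (forall g, Ps g -> ~ p (g ▷ d)%F) ->
  exists x : mcs, crit p d x /\ Ps `<=` wset x.
Proof.
move=> [g0 Pg0] dir con.
pose Th := [set a | exists g e, [/\ Ps g, p (e ▷ d)%F & a = (g && ~~ e)%F]].
have [||_ [g [e [Pg pe ->]]] h|x hx] := @extend_directed Th.
- by exists (g0 && ~~ d)%F, g0, d; split=> //; apply: rhd_box.
- move=> _ _ [g [e [Pg pe ->]]] [g' [e' [Pg' pe' ->]]].
  have [c [Pc cg cg']] := dir _ _ Pg Pg'.
  exists (c && ~~ (e || e'))%F; split.
  + by exists c, (e || e')%F; split=> //; apply: rhd_or.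
  + apply/worldsP => y; apply/wImp => /wAnd[yc /wNot]; rewrite wOr => ne; apply/wAnd; split.
      by move: (wL y cg) => /wImp; apply.
    by apply/wNot => ye; apply: ne; left.
  + apply/worldsP => y; apply/wImp => /wAnd[yc /wNot]; rewrite wOr => ne; apply/wAnd; split.
      by move: (wL y cg') => /wImp; apply.
    by apply/wNot => ye; apply: ne; right.
- apply: con Pg _; apply: rhd_trans pe; apply: rhd_box => y _ yg.
  apply: contrapT => /wNot yNe.
  by have /wNot := wL y h; apply; apply/wAnd.
exists x; split=> [e pe xe|g Pg].
  have /wAnd[_ /wNot] : x (g0 && ~~ e)%F by apply: hx; exists g0, e.
  by apply.
by have /wAnd[] : x (g && ~~ d)%F by apply: hx; exists g, d; split=> //; apply: rhd_box.
Qed.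

Lemma crit_exists (p : mcs) b d : ~ p (b ▷ d)%F -> exists x : mcs, crit p d x /\ x b.
Proof.
move=> nbd; have [||_ ->//|x [cx hx]] := @crit_extend p d [set b].
- by exists b.
- by move=> _ _ -> ->; exists b; split=> //; apply/worldsP => y; apply/wImp.
- by exists x; split=> //; apply: hx.
Qed.

Lemma crit_jump (p x : mcs) a b d : p (a ▷ b)%F -> crit p d x -> x a -> ~ p (b ▷ d)%F.
Proof. by move=> ab cx xa bd; apply: cx xa; apply: rhd_trans bd. Qed.

(* A single world may avoid [d] and still contain all boxes of [u], each of which is carried
   along by [M]. *)
Lemma crit_jumpM (p u : mcs) a b d : L axM -> p (a ▷ b)%F -> crit p d u -> u a ->
  exists x : mcs, [/\ crit p d x, x b & incl u x].
Proof.
move=> LM ab cu ua.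
pose Ps := [set (b && □ g)%F | g in [set g | u (□ g)%F]].
have uT : u (□ ⊤)%F by apply/wNec/taut.
have [||_ [g ug <-] bd|x [cx hx]] := @crit_extend p d Ps.
- by exists (b && □ ⊤)%F, ⊤%F.
- move=> _ _ [g ug <-] [g' ug' <-]; exists (b && □ (g && g'))%F; split.
  + by exists (g && g')%F => //=; apply: box_and.
  + apply/worldsP => y; apply/wImp => /wAnd[yb yg]; apply/wAnd; split=> //.
    by apply: box_mono yg => z /wAnd[].
  + apply/worldsP => y; apply/wImp => /wAnd[yb yg]; apply/wAnd; split=> //.
    by apply: box_mono yg => z /wAnd[].
- have : p ((a && □ g) ▷ (b && □ g))%F.
    by have /wImp := wL p (@ax3 _ a b g LM); apply.
  by move=> /rhd_trans/(_ bd)/cu; apply; apply/wAnd.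
exists x; split=> //.
  by have /wAnd[] := hx _ (ex_intro2 _ _ ⊤%F uT erefl).
by move=> g ug; have /wAnd[] := hx _ (ex_intro2 _ _ g ug erefl).
Qed.

End Worlds.

(** * Kripke frames and the ultrabouquet *)

Record frame : Type := Frame {
  fcar :> Type;
  acc : fcar -> fcar -> Prop;
  lnk : fcar -> fcar -> Prop }.

Fixpoint sat (F : frame) (v : nat -> set F) (x : F) (a : formula) : Prop :=
  match a with
  | Var n => v n x
  | Top => True
  | Bot => False
  | Not b => ~ sat v x b
  | And b c => sat v x b /\ sat v x c
  | Or b c => sat v x b \/ sat v x c
  | Imp b c => sat v x b -> sat v x c
  | Box b => forall y, acc x y -> sat v y b
  | Rhd b c => forall y, acc x y -> sat v y b ->
      exists z, [/\ acc x z, lnk y z & sat v z c]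
  end.

Record CL_frame (F : frame) : Prop := CLFrame {
  acc_trans : forall x y z : F, acc x y -> acc y z -> acc x z;
  acc_wf : exists (h : F -> nat) N, forall x y : F, acc x y -> h x < h y <= N;
  lnk_refl : forall x : F, lnk x x;
  lnk_trans : forall x y z : F, lnk x y -> lnk y z -> lnk x z }.

Definition valid (F : frame) : set formula :=
  [set a | forall (v : nat -> set F) x, sat v x a].

(** * Soundness of the schemes on Kripke frames *)

Section Soundness.

Variable F : frame.
Hypothesis FCL : CL_frame F.

Lemma sat_subst (v : nat -> set F) s x a :
  sat v x (subst s a) <-> sat (fun n => [set y | sat v y (s n)]) x a.
Proof.
elim: a x => //=.
- by move=> a IH x; rewrite IH.
- by move=> a IHa b IHb x; rewrite IHa IHb.
- by move=> a IHa b IHb x; rewrite IHa IHb.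
- by move=> a IHa b IHb x; rewrite IHa IHb.
- by move=> a IH x; split=> h y xy; apply/IH/h.
- move=> a IHa b IHb x; split=> h y xy.
    by move=> /IHa/(h _ xy)[z [xz yz /IHb]]; exists z.
  by move=> /IHa/(h _ xy)[z [xz yz /IHb]]; exists z.
Qed.

Lemma valid_closed : closed_under_rules (valid F).
Proof.
split.
- by move=> a b hab ha v x; have := hab v x => /=; apply; apply: ha.
- by move=> a ha v x y _; apply: ha.
- by move=> s a ha v x; apply/sat_subst/ha.
Qed.

Lemma sat_beval (v : nat -> set F) x a :
  sat v x a <-> beval (fun b => `[<sat v x b>]) a.
Proof.
elim: a => /=.
- by move=> n; split=> [/asboolP|/asboolP].
- by [].
- by [].
- by move=> a IH; rewrite IH; split=> /negP.
- by move=> a IHa b IHb; rewrite IHa IHb; split=> /andP.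
- by move=> a IHa b IHb; rewrite IHa IHb; split=> /orP.
- by move=> a IHa b IHb; rewrite IHa IHb; split=> /implyP.
- by move=> a _; split=> [/asboolP|/asboolP].
- by move=> a _ b _; split=> [/asboolP|/asboolP].
Qed.

Lemma valid_taut : tautology `<=` valid F.
Proof. by move=> a ta v x; apply/sat_beval/ta. Qed.

Lemma valid_CL : CL `<=` valid F.
Proof.
apply: smallest_sub; first exact: valid_closed.
rewrite subUset; split; first exact: valid_taut.
have [h [N hN]] := acc_wf FCL.
move=> _ [[[[[->|->]|->]|->]|->]|->] v x /=.
- by move=> hab ha y xy; apply: hab => //; apply: ha.
(* Löb's scheme, by induction on the height left above [y]. *)
- move=> hL y xy; have [n] := ubnP (N - h y).
  elim: n => // n IH in y xy *; rewrite ltnS => hn.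
  apply: (hL _ xy) => z yz; apply: IH (acc_trans FCL xy yz) _.
  have /andP[yz' zN] := hN _ _ yz.
  by apply: leq_trans hn; apply: ltn_sub2l => //; apply: leq_trans zN.
- by move=> hab y xy ya; exists y; split=> //; [exact: (lnk_refl FCL)|exact: hab].
- move=> [hab hbc] y xy /(hab _ xy)[z [xz yz]] /(hbc _ xz)[w [xw zw wc]].
  by exists w; split=> //; apply: (lnk_trans FCL) yz zw.
- by move=> [hac hbc] y xy [/(hac _ xy)|/(hbc _ xy)].
- move=> hab nNa Nb; apply: nNa => y xy /(hab _ xy)[z [xz _ zb]].
  exact: Nb xz zb.
Qed.

Lemma valid_extend K chi : K `<=` valid F -> valid F chi -> extend K chi `<=` valid F.
Proof.
move=> KF vchi; apply: smallest_sub; first exact: valid_closed.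
by rewrite subUset; split=> // _ ->.
Qed.

Lemma valid_J5 : (forall y z : F, acc y z -> lnk y z) -> valid F axJ5.
Proof.
move=> h v x /= y xy nN; apply: contrapT => nz; apply: nN => z yz zp.
by apply: nz; exists z; split=> //; [exact: (acc_trans FCL) xy yz|exact: h].
Qed.

Lemma valid_M : (forall y z u : F, lnk y z -> acc z u -> acc y u) -> valid F axM.
Proof.
move=> h v x /= hpq y xy [yp yr]; have [z [xz yz zq]] := hpq _ xy yp.
by exists z; split=> //; split=> // u zu; apply: yr; apply: h yz zu.
Qed.

Lemma valid_P :
  (forall x x' y z : F, acc x x' -> acc x' y -> lnk y z -> acc x z -> acc x' z) ->
  valid F axP.
Proof.
move=> h v x /= hpq x' xx' y x'y yp.
have [z [xz yz zq]] := hpq _ (acc_trans FCL xx' x'y) yp.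
by exists z; split=> //; apply: h xx' x'y yz xz.
Qed.

(* Take a link-successor satisfying [q] of maximal measure. *)
Lemma valid_W : (forall y z : F, acc y z -> lnk y z) ->
  (exists (mu : F -> nat) N, [/\ forall x, mu x <= N,
     forall x y, acc x y -> mu x < mu y & forall x y, lnk x y -> mu x <= mu y]) ->
  valid F axW.
Proof.
move=> hj [mu [N [muN mua mul]]] v x /= hpq y xy yp.
apply: contrapT => nz.
suff : forall n, exists z, [/\ acc x z, lnk y z, sat v z (Var 1) & n <= mu z].
  by move=> /(_ N.+1)[z [_ _ _]]; rewrite ltnNge muN.
elim=> [|n [z [xz yz zq nz']]]; first by have [z []] := hpq _ xy yp; exists z.
have [z' zz' z'p] : exists2 z', acc z z' & v 0 z'.
  apply: contrapT => nz''; apply: nz; exists z; split=> //; split=> // u zu up.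
  by apply: nz''; exists u.
have [u [xu z'u uq]] := hpq _ (acc_trans FCL xz zz') z'p.
exists u; split=> //.
  exact: (lnk_trans FCL) yz (lnk_trans FCL (hj _ _ zz') z'u).
by apply: leq_ltn_trans nz' _; apply: leq_trans (mua _ _ zz') (mul _ _ z'u).
Qed.

End Soundness.

(* The ultrabouquet of a family of rooted frames: a new point [None] is put below the
   non-root points of all the frames at once, and its neighbourhoods have to contain the
   successors of almost all the roots with respect to the ultrafilter [U]. *)
Section Bouquet.

Variables (I : eqType) (F : I -> frame) (r : forall i, F i) (U : set_system I).
Hypothesis UU : UltraFilter U.
Hypothesis FCL : forall i, CL_frame (F i).

Definition bouquet : Type := option {i : I & F i}.

Definition leaf i (x : F i) : bouquet := Some (existT F i x).

Definition open_acc (A : set bouquet) : Prop :=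
  (forall i (x y : F i), A (leaf x) -> acc x y -> A (leaf y)) /\
  (A None -> U [set i | forall y, acc (r i) y -> A (leaf y)]).

(** [None] is unconstrained, as links stay inside the single frames. *)
Definition open_lnk (A : set bouquet) : Prop :=
  forall i (x y : F i), A (leaf x) -> lnk x y -> A (leaf y).

Lemma open_accT : open_acc setT.
Proof. by split=> // _; apply: filterS filterT. Qed.

Lemma open_accI A B : open_acc A -> open_acc B -> open_acc (A `&` B).
Proof.
move=> [A1 A2] [B1 B2]; split=> [i x y [Ax Bx] xy|[/A2 uA /B2 uB]].
  by split; [exact: A1 xy|exact: B1 xy].
by apply: filterS2 uA uB => i Ai Bi y ry; split; [exact: Ai|exact: Bi].
Qed.

Lemma open_acc_bigU (J : Type) (f : J -> set bouquet) :
  (forall j, open_acc (f j)) -> open_acc (\bigcup_j f j).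
Proof.
move=> fo; split=> [i x y [j _ fx] xy|[j _ fN]].
  by exists j => //; case: (fo j) => + _; apply; [exact: fx|].
by case: (fo j) => _ /(_ fN); apply: filterS => i h y ry; exists j => //; apply: h.
Qed.

Lemma open_lnkT : open_lnk setT. Proof. by []. Qed.

Lemma open_lnkI A B : open_lnk A -> open_lnk B -> open_lnk (A `&` B).
Proof. by move=> hA hB i x y [Ax Bx] xy; split; [exact: hA xy|exact: hB xy]. Qed.

Lemma open_lnk_bigU (J : Type) (f : J -> set bouquet) :
  (forall j, open_lnk (f j)) -> open_lnk (\bigcup_j f j).
Proof. by move=> fo i x y [j _ fx] xy; exists j => //; apply: fo xy. Qed.

(** Two synonyms of one type, so that each can carry its own topology. *)
Definition space0 : Type := bouquet.
HB.instance Definition _ := gen_eqMixin space0.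
HB.instance Definition _ := gen_choiceMixin space0.
HB.instance Definition _ :=
  isOpenTopological.Build space0 open_accT open_accI open_acc_bigU.

Definition space1 : Type := bouquet.
HB.instance Definition _ := gen_eqMixin space1.
HB.instance Definition _ := gen_choiceMixin space1.
HB.instance Definition _ :=
  isOpenTopological.Build space1 open_lnkT open_lnkI open_lnk_bigU.

Lemma bouquet_nonempty : [set: bouquet] !=set0. Proof. by exists None. Qed.

Definition bouquet_space : bitopSpace :=
  @BitopSpace bouquet (Topological.class space0) (Topological.class space1)
    bouquet_nonempty.

Let X := bouquet_space.

Lemma is_open0 A : is_open (tau0 X) A = open_acc A. Proof. by []. Qed.

Lemma leaf_inj i : injective (@leaf i).
Proof. by move=> x y [e]; apply: eq_from_Tagged e. Qed.

Lemma acc_irr i (x : F i) : ~ acc x x.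
Proof.
by have [h [N hN]] := acc_wf (FCL i); move=> /hN; rewrite ltnn.
Qed.

Lemma ultraN (A : set I) : U (~` A) <-> ~ U A.
Proof.
split=> [uNA uA|nA]; last by have [] := in_ultra_setVsetC A UU.
by have [i []] := filter_ex (filterI uA uNA).
Qed.

(** [x] with its successors is the least neighbourhood of [leaf x], and irreflexivity makes its
    punctured part the set of successors. *)
Lemma d_leaf (Y : set X) i (x : F i) :
  d (tau0 X) Y (leaf x) <-> exists y, acc x y /\ Y (leaf y).
Proof.
rewrite dE; split=> [h|[y [xy Yy]] V].
- have [||_ [[y [-> [->|xy]]] [Yy nyx]]] :=
    h [set b : X | exists y : F i, b = leaf y /\ (y = x \/ acc x y)].
  + rewrite is_open0; split=> [j y z [y' [e hy]] yz|[y []]//].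
    have ij : j = i by case: e.
    subst j; exists z; split=> //; right; move/leaf_inj: e => e; subst y'.
    by case: hy => [<-//|xy]; apply: acc_trans (FCL i) _ _ _ xy yz.
  + by exists x; split=> //; left.
  + by case: nyx.
  + by exists y.
- rewrite is_open0 => -[oV _] Vx; exists (leaf y); split; first exact: oV xy.
  by split=> // /leaf_inj e; move: xy; rewrite e; apply: acc_irr.
Qed.

(** If almost all roots had no successor in [Y], then [None] with the successors of these roots
    would be a neighbourhood whose other points avoid [Y]. *)
Lemma d_None (Y : set X) :
  d (tau0 X) Y None <-> U [set i | exists y, acc (r i) y /\ Y (leaf y)].
Proof.
rewrite dE; split=> [h|uY V].
- apply: contrapT => /ultraN uC; set C := ~` _ in uC.
  have [||_ [[->|[i [y [Ci ry ->]]]] [Yy nN]]] :=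
    h [set b : X | b = None \/ exists i (y : F i), [/\ C i, acc (r i) y & b = leaf y]].
  + rewrite is_open0; split=> [j y z [//|[i [y' [Ci ry e]]]] yz|_].
      right; have ij : j = i by case: e.
      subst j; exists i, z; split=> //; move/leaf_inj: e => e; subst y'.
      exact: acc_trans (FCL i) _ _ _ ry yz.
    by apply: filterS uC => i Ci y ry; right; exists i, y.
  + by left.
  + by apply: nN.
  + by apply: Ci; exists y.
- rewrite is_open0 => -[_ /[apply]/(filterI uY)/filter_ex[i [[y [ry Yy]] Vi]]].
  by exists (leaf y); split; [exact: Vi|split].
Qed.

(** The link-successors of one point form an open set around it, by transitivity and reflexivity. *)
Lemma e_leaf (Y Z : set X) i (x : F i) :
  e (tau0 X) (tau1 X) Y Z (leaf x) <->
  forall y, acc x y -> Y (leaf y) -> exists z, [/\ acc x z, lnk y z & Z (leaf z)].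
Proof.
split=> [h y xy Yy|h V oV].
- have [||z [xz [Zz [z' [/leaf_inj zz' yz]]]]] :=
    (d_leaf _ x).1 (h [set b : X | exists z : F i, b = leaf z /\ lnk y z] _ _).
  + move=> j z u [z' [e yz]] zu; have ij : j = i by case: e.
    subst j; exists u; split=> //; move/leaf_inj: e => e; subst z'.
    exact: lnk_trans (FCL i) _ _ _ yz zu.
  + apply/d_leaf; exists y; split=> //; split=> //; exists y; split=> //.
    exact: lnk_refl (FCL i) _.
  + by exists z; split=> //; rewrite zz'.
- move=> /d_leaf[y [xy [Yy Vy]]]; have [z [xz yz Zz]] := h _ xy Yy.
  by apply/d_leaf; exists z; split=> //; split=> //; apply: oV yz.
Qed.

Lemma e_None (Y Z : set X) :
  e (tau0 X) (tau1 X) Y Z None <->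
  U [set i | forall y, acc (r i) y -> Y (leaf y) ->
       exists z, [/\ acc (r i) z, lnk y z & Z (leaf z)]].
Proof.
split=> [h|uh V oV].
- apply: contrapT => /ultraN uC; set C := ~` _ in uC.
  pose B i (y : F i) := [/\ acc (r i) y, Y (leaf y) &
    forall z, acc (r i) z -> lnk y z -> ~ Z (leaf z)].
  have CB i : C i -> exists y, B i y.
    move=> Ci; apply: contrapT => nB; apply: Ci => y ry Yy.
    apply: contrapT => nz; apply: nB; exists y; split=> // z rz yz Zz.
    by apply: nz; exists z.
  (* [V] collects the link-successors of all counterexamples: [Y] still accumulates at [None] inside
     [V], but no successor of a root that lies in [V] is in [Z]. *)
  pose V := [set b : X | exists i (z y : F i), [/\ b = leaf z, B i y & lnk y z]].
  have /d_None/filter_ex[i [z [rz [Zz [j [z' [y [e By yz]]]]]]]] :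
      d (tau0 X) (Z `&` V) None.
    apply: h.
      move=> j z u [i [z' [y [e By yz]]]] zu; have ij : j = i by case: e.
      subst j; exists i, u, y; split=> //; move/leaf_inj: e => e; subst z'.
      exact: lnk_trans (FCL i) _ _ _ yz zu.
    apply/d_None; apply: filterS uC => i /CB[y By]; exists y.
    case: (By) => ry Yy _; split=> //; split=> //; exists i, y, y; split=> //.
    exact: lnk_refl (FCL i) _.
  have ij : j = i by case: e.
  subst j; move/leaf_inj: e => e; subst z'; case: By => _ _ /(_ _ rz yz).
  exact.
- move=> /d_None/(filterI uh) uY; apply/d_None.
  apply: filterS uY => i [hi [y [ry [Yy Vy]]]]; have [z [rz yz Zz]] := hi _ ry Yy.
  by exists z; split=> //; split=> //; apply: oV yz.
Qed.

Lemma eval_leaf (v : nat -> set X) a i (x : F i) :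
  Defs.eval v a (leaf x) <-> sat (fun n => [set y | v n (leaf y)]) x a.
Proof.
elim: a x => //=.
- by move=> a IH x; rewrite /setC /= IH.
- by move=> a IHa b IHb x; rewrite /setI /= IHa IHb.
- by move=> a IHa b IHb x; rewrite /setU /= IHa IHb.
- move=> a IHa b IHb x; rewrite /setU /setC /= IHa IHb; split=> [[|]//|h].
  by have [/h|] := pselect (sat (fun n => [set y | v n (leaf y)]) x a); [right|left].
- move=> a IH x; rewrite /cd /setC /= d_leaf; split=> [h y xy|h [y [xy]]].
    by apply/IH; apply: contrapT => ny; apply: h; exists y.
  by apply; apply/IH/h.
- move=> a IHa b IHb x; rewrite e_leaf; split=> h y xy.
    by move=> /IHa/(h _ xy)[z [xz yz /IHb]]; exists z.
  by move=> /IHa/(h _ xy)[z [xz yz /IHb]]; exists z.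
Qed.

Section RootValuation.

Variables (v : nat -> set X) (w : forall i, nat -> set (F i)).
Arguments w : clear implicits.
Hypothesis wv : forall i y, acc (r i) y -> forall n, w i n y <-> v n (leaf y).
Hypothesis wr : forall n, v n None <-> U [set i | w i n (r i)].

Lemma sat_above a i y : acc (r i) y ->
  sat (w i) y a <-> Defs.eval v a (leaf y).
Proof.
rewrite eval_leaf; elim: a y => //=.
- by move=> n y ry; apply: wv.
- by move=> a IH y ry; rewrite IH.
- by move=> a IHa b IHb y ry; rewrite IHa// IHb.
- by move=> a IHa b IHb y ry; rewrite IHa// IHb.
- by move=> a IHa b IHb y ry; rewrite IHa// IHb.
- move=> a IH y ry; split=> h z yz; have rz := acc_trans (FCL i) ry yz;
    exact/(IH _ rz)/h.
- move=> a IHa b IHb y ry; split=> h z yz; have rz := acc_trans (FCL i) ry yz.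
    move=> /(IHa _ rz)/(h _ yz)[u [yu zu ub]]; exists u; split=> //.
    exact/(IHb _ (acc_trans (FCL i) ry yu)).
  move=> /(IHa _ rz)/(h _ yz)[u [yu zu ub]]; exists u; split=> //.
  exact/(IHb _ (acc_trans (FCL i) ry yu)).
Qed.

(** Łoś's theorem for the roots: the ultrafilter commutes with the connectives, and modal formulas
    inspect only points above the roots, where [w] and [v] agree. *)
Lemma eval_None a : Defs.eval v a None <-> U [set i | sat (w i) (r i) a].
Proof.
elim: a => /=.
- exact: wr.
- by split=> // _; apply: filterS filterT.
- split=> // /filter_ex[i []].
- by move=> a IH; rewrite /setC /= IH -ultraN.
- move=> a IHa b IHb; rewrite /setI /= IHa IHb; split=> [[]|uab].
    exact: filterI.
  by split; apply: filterS uab => i [].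
- move=> a IHa b IHb; rewrite /setU /= IHa IHb; split.
    by case; apply: filterS => i; [left|right].
  move=> uab; apply: contrapT => /not_orP[/ultraN na /ultraN nb].
  by have [i [[|]]] := filter_ex (filterI uab (filterI na nb)); move=> ? [].
- move=> a IHa b IHb; rewrite /setU /setC /= IHa IHb; split.
    by case=> [/ultraN ua|ub]; [apply: filterS ua => i nai /nai|apply: filterS ub => i ib _].
  move=> uab; have [ua|] := pselect (U [set i | sat (w i) (r i) a]); last by left.
  by right; apply: filterS2 uab ua => i; apply.
- move=> a IH; rewrite /cd /setC /= d_None -ultraN; split; apply: filterS => i h.
    move=> y ry; apply/sat_above => //; apply: contrapT => ny; apply: h.
    by exists y.
  by move=> [y [ry]]; apply; apply/sat_above/h.
- move=> a IHa b IHb; rewrite e_None; split; apply: filterS => i h y ry.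
    move=> /(sat_above a ry)/(h _ ry)[z [rz yz zb]]; exists z; split=> //.
    exact/sat_above.
  move=> /(sat_above a ry)/(h _ ry)[z [rz yz zb]]; exists z; split=> //.
  exact/sat_above.
Qed.

End RootValuation.

Lemma bouquet_Log K : (forall i, K `<=` valid (F i)) -> is_space_of K X.
Proof.
move=> KF a Ka v; apply/seteqP; split=> // -[[i x]|] _.
  by apply/eval_leaf/KF.
(* Every root receives the truth values of [None], so that validity in the frames passes to
   [None]. *)
pose w i n := [set y : F i | (y <> r i /\ v n (leaf y)) \/ (y = r i /\ v n None)].
apply/(@eval_None v w) => [i y ry n|n|].
- have nyr : y <> r i by move=> e; move: ry; rewrite e; apply: acc_irr.
  by rewrite /w /=; split=> [[[]|[]]//|]; left.
- split=> [vN|/filter_ex[i [[]|[]]]//].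
  by apply: filterS filterT => i _; right.
- by apply: filterS filterT => i _; apply: KF.
Qed.

Lemma bouquet_entails K (w : forall i, nat -> set (F i)) (G : set formula) a :
  (forall i, K `<=` valid (F i)) -> entails K G a ->
  (forall b, G b -> U [set i | sat (w i) (r i) b]) ->
  U [set i | sat (w i) (r i) a].
Proof.
move=> KF ent Gw.
pose v n := [set b : X | match b with
  | Some (existT i y) => w i n y | None => U [set i | w i n (r i)] end].
have ev b : Defs.eval v b None <-> U [set i | sat (w i) (r i) b] by apply: eval_None.
by apply/ev/ent => [|b /Gw/ev]; first exact: bouquet_Log.
Qed.

End Bouquet.

(** * The frame of histories *)

Record sub_closed (Phi : seq formula) : Prop := SubClosed {
  closedN : forall a, (~~ a)%F \in Phi -> a \in Phi;
  closedA : forall a b, (a && b)%F \in Phi -> a \in Phi /\ b \in Phi;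
  closedO : forall a b, (a || b)%F \in Phi -> a \in Phi /\ b \in Phi;
  closedI : forall a b, (a ==> b)%F \in Phi -> a \in Phi /\ b \in Phi;
  closedB : forall a, (□ a)%F \in Phi -> a \in Phi;
  closedR : forall a b, (a ▷ b)%F \in Phi -> a \in Phi /\ b \in Phi }.

(* Which of the schemes J5, M, P and W the model has to validate. *)
Record flags : Type := Flags { fJ : bool; fM : bool; fP : bool; fW : bool }.

Section Histories.

Variables (L : set formula) (Phi : seq formula) (fl : flags).

Notation W := (mcs L).
Notation lab := (set W * nat)%type.

(* [lt] is the accessibility on worlds that the histories realize, [jmp] holds between the worlds
   of linked histories, and [live p] singles out the labels available for successors of [p]. The
   second component of a label is the counter that is used for W. *)
Record system : Type := System {
  lt : W -> W -> Prop;
  jmp : W -> W -> Prop;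
  live : W -> lab -> Prop;
  rk : W -> nat;
  rk_max : nat;
  lab_max : nat;
  lt_trans : forall x y z, lt x y -> lt y z -> lt x z;
  lt_box : forall (x y : W) a, lt x y -> (□ a)%F \in Phi -> x (□ a)%F -> y a;
  lt_rk : forall x y, lt x y -> rk x < rk y <= rk_max;
  lt_dia : forall (x : W) a, (□ a)%F \in Phi -> ~ x (□ a)%F -> exists2 y, lt x y & ~ y a;
  jmp_lt : fM fl -> forall x y z, jmp x y -> lt y z -> lt x z;
  live_lt : forall p l x, live p l -> l.1 x -> lt p x;
  live_up : fJ fl -> forall p l x y, live p l -> l.1 x -> lt x y -> l.1 y;
  live_all : forall p, live p ([set x | lt p x], 0);
  live_need : forall (p : W) a b, (a ▷ b)%F \in Phi -> ~ p (a ▷ b)%F ->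
    exists (G : set W) (x : W), [/\ live p (G, 0), G x, x a & forall y : W, G y -> ~ y b];
  live_jump : forall (p : W) l (x : W) a b, (a ▷ b)%F \in Phi -> p (a ▷ b)%F ->
    live p l -> l.1 x -> x a -> exists l' (z : W),
    [/\ live p l' /\ l'.1 z, z b /\ jmp x z,
        l'.1 `<=` l.1 /\ l.2 <= l'.2 <= lab_max,
        fM fl -> l' = l &
        fW fl -> l.2 < l'.2 \/ forall c, l.1 c -> ~ lt c x];
  lt_rhd : fP fl -> forall (x y : W) a b, x (a ▷ b)%F -> lt x y -> y (a ▷ b)%F }.

Variable Sy : system.
Hypothesis WJ : fW fl -> fJ fl /\ ~~ fM fl.
Hypothesis PJ : fP fl -> fJ fl /\ ~~ fM fl.
Hypothesis nL : normal L.
Hypothesis Phi_closed : sub_closed Phi.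

(* Points of the model are histories: [Fresh y l x] is a new successor of [y], and
   [Jump y q l x] is a new successor of [q] to which [y], itself above [q], is linked.
   The label [l] is a set of worlds that links may not leave as long as they stay above
   the parent. *)
Inductive node : Type :=
| Root of W
| Fresh of node & lab & W
| Jump of node & node & lab & W.

Definition pt (z : node) : W :=
  match z with Root x => x | Fresh _ _ x => x | Jump _ _ _ x => x end.

Definition prev (z : node) : node :=
  match z with Root _ => z | Fresh y _ _ => y | Jump y _ _ _ => y end.

Definition par (z : node) : node :=
  match z with Root _ => z | Fresh y _ _ => y | Jump _ q _ _ => q end.

Fixpoint pre (p z : node) : Prop := p = z \/
  match z with
  | Root _ => False | Fresh y _ _ => pre p y | Jump y _ _ _ => pre p y
  end.

(** Fresh steps count as links only if J5 requires links to contain accessibility. *)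
Fixpoint link (p z : node) : Prop := p = z \/
  match z with
  | Root _ => False | Fresh y _ _ => fJ fl /\ link p y | Jump y _ _ _ => link p y
  end.

(** Without M these are the ancestors along parents. With M the whole history of the parent counts,
    since a link followed by accessibility has to be accessibility. *)
Fixpoint above (p z : node) : Prop :=
  match z with
  | Root _ => False
  | Fresh q _ _ | Jump _ q _ _ => if fM fl then pre p q else p = q \/ above p q
  end.

(* The label by which [z] is confined as a point above [p]. *)
Fixpoint clab (p z : node) : lab :=
  match z with
  | Root _ => ([set x | lt Sy (pt p) x], 0)
  | Fresh y l _ =>
    if `[<p = y>] then l else
    if fJ fl then clab p y else ([set x | lt Sy (pt p) x], 0)
  | Jump y q l _ =>
    if `[<p = q>] then l else
    if fJ fl then (if fM fl then clab p y else clab p q)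
    else ([set x | lt Sy (pt p) x], 0)
  end.

(** The label of a jump refines the confinement of [y] above [q]. With M it stays the same, with P
    jumps lead only to children of the same parent, and with W a jump made for a remoter ancestor
    raises the counter. *)
Fixpoint ok (z : node) : Prop :=
  match z with
  | Root _ => True
  | Fresh y l x => [/\ ok y, live Sy (pt y) l, l.1 x & l.2 = 0]
  | Jump y q l x =>
    [/\ ok y, above q y, live Sy (pt q) l /\ l.1 x, jmp Sy (pt y) x &
    [/\ l.1 `<=` (clab q y).1, (clab q y).2 <= l.2 <= lab_max Sy,
        fM fl -> l = clab q y, fP fl -> q = par y &
        fW fl -> par y <> q -> (clab q y).2 < l.2]]
  end.

Fixpoint nsize (z : node) : nat :=
  match z with
  | Root _ => 0 | Fresh y _ _ => (nsize y).+1 | Jump y q _ _ => (nsize y).+1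
  end.

Lemma pre_refl z : pre z z. Proof. by case: z => *; left. Qed.

Lemma pre_size p z : pre p z -> p = z \/ nsize p < nsize z.
Proof.
elim: z => [x|y IH l x|y IH q _ l x] /= [->|] //; try by left.
  by move=> /IH[->|h]; right; rewrite ltnS// ltnW.
by move=> /IH[->|h]; right; rewrite ltnS// ltnW.
Qed.

Lemma pre_trans p q z : pre p q -> pre q z -> pre p z.
Proof.
elim: z => [x|y IH l x|y IH q' _ l x] pq /= [qz|h]; try (by subst q); try by case: h.
  by right; apply: IH.
by right; apply: IH.
Qed.

Lemma pre_anti p q : pre p q -> pre q p -> p = q.
Proof.
by move=> /pre_size[//|h] /pre_size[//|]; rewrite ltnNge ltnW.
Qed.

Lemma pre_prev p z : pre p z -> p = z \/ pre p (prev z).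
Proof. by case: z => [x|y l x|y q l x] /= [->|]; by [left|right]. Qed.

Lemma prev_pre z : pre (prev z) z.
Proof.
by case: z => [x|y l x|y q l x] /=; [left|right; exact: pre_refl|right; exact: pre_refl].
Qed.

Lemma pre_total a b z : pre a z -> pre b z -> pre a b \/ pre b a.
Proof.
elim: z a b => [x|y IH l x|y IH q _ l x] a b /= [->|h1] [->|h2];
  try by [left; left|right; right|left; right].
- by [].
- exact: IH.
- exact: IH.
Qed.

Lemma link_pre p z : link p z -> pre p z.
Proof.
elim: z => [x|y IH l x|y IH q _ l x] //=.
  by case=> [->|[_ /IH]]; [left|right].
by case=> [->|/IH]; [left|right].
Qed.

Lemma link_preJ p z : fJ fl -> link p z <-> pre p z.
Proof.
move=> j; split; first exact: link_pre.
elim: z => [x|y IH l x|y IH q _ l x] //=.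
  by case=> [->|/IH]; [left|right].
by case=> [->|/IH]; [left|right].
Qed.

Lemma link_refl z : link z z. Proof. by case: z => *; left. Qed.

Lemma link_trans p q z : link p q -> link q z -> link p z.
Proof.
elim: z => [x|y IH l x|y IH q' _ l x] pq /= [qz|h]; try (by subst q); try by case: h.
  by case: h => j h; right; split=> //; apply: IH.
by right; apply: IH.
Qed.

Lemma ok_prev z : ok z -> ok (prev z).
Proof. by case: z => [x|y l x|y q l x] //= []. Qed.

Lemma ok_pre p z : ok z -> pre p z -> ok p.
Proof.
elim: z => [x _ [->//|[]]|y IH l x okz|y IH q _ l x okz] /= [->//|].
  by apply: IH; apply: ok_prev okz.
by apply: IH; apply: ok_prev okz.
Qed.

Lemma above_pre p z : ok z -> above p z -> pre p (par z) /\ pre (par z) (prev z).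
Proof.
move: {2}(nsize z).+1 (ltnSn (nsize z)) => n; elim: n => // n IH in p z *.
rewrite ltnS; case: z => [x|y l x|y q l x] //= ny.
  case=> oky _ _ _; case: ifP => _; first by move=> py; split=> //; apply: pre_refl.
  case=> [->|/(IH _ _ ny oky)[py ppy]]; split; try exact: pre_refl.
  exact: pre_trans py (pre_trans ppy (prev_pre y)).
case=> oky qy _ _ _; have [qpy ppy] := IH _ _ ny oky qy.
have qy' : pre q y := pre_trans qpy (pre_trans ppy (prev_pre y)).
move=> pq; split=> //; move: pq; case: ifP => // _ [->|pq]; first exact: pre_refl.
have nq : nsize q < n.
  by case: (pre_size qy') => [->//|/ltn_trans]; apply.
have [h1 h2] := IH _ _ nq (ok_pre oky qy') pq.
exact: pre_trans h1 (pre_trans h2 (prev_pre q)).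
Qed.

Lemma ok_par z : ok z -> ok (par z).
Proof.
case: z => [x|y l x|y q l x] //= [] // oky /(above_pre oky)[h1 h2] _ _ _.
exact: ok_pre oky (pre_trans h1 (pre_trans h2 (prev_pre y))).
Qed.

Lemma above_preW p z : ok z -> above p z -> pre p z.
Proof.
move=> okz /(above_pre okz)[h1 h2].
exact: pre_trans h1 (pre_trans h2 (prev_pre z)).
Qed.

Definition top (p : node) : lab := ([set x | lt Sy (pt p) x], 0).

(** The condition under which the children of [q] lie above [p]. *)
Definition base (p q : node) : Prop := if fM fl then pre p q else p = q \/ above p q.

Lemma base_above p q z : ok q -> base p q -> above q z -> above p z.
Proof.
rewrite /base => okq.
elim: z => [x|y IHy l x|y IHy q' IHq l x] //=; case m: (fM fl) => pq //.
- exact: pre_trans.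
- case: pq => pq; first by rewrite pq.
  by case=> [e|qy]; [subst y; right|right; apply: IHy => //; rewrite m; right].
- exact: pre_trans.
- case: pq => pq; first by rewrite pq.
  by case=> [e|qy]; [subst q'; right|right; apply: IHq => //; rewrite m; right].
Qed.

Lemma above_base p q : ok q -> above p q -> base p q.
Proof. by rewrite /base => okq; case: ifP => _; [exact: above_preW|right]. Qed.

Lemma above_trans p q z : ok q -> above p q -> above q z -> above p z.
Proof. by move=> okq pq; apply: base_above => //; apply: above_base. Qed.

Lemma par_lt z : ok z -> above (par z) z -> lt Sy (pt (par z)) (pt z).
Proof.
case: z => [x|y l x|y q l x] //= [] //.
  by move=> _ h1 h2 _ _; apply: live_lt h1 h2.
by move=> _ _ [h1 h2] _ _ _; apply: live_lt h1 h2.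
Qed.

Lemma pre_lt p z x : fM fl -> ok z -> pre p z -> lt Sy (pt z) x -> lt Sy (pt p) x.
Proof.
move=> m; elim: z => [y|y IH l w|y IH q _ l w] okz /= [->//|] // py wx.
  by case: okz => oky h1 h2 _; apply: IH => //; apply: lt_trans wx; apply: live_lt h1 h2.
by case: okz => oky _ _ yw _; apply: IH => //; apply: jmp_lt yw wx.
Qed.

Lemma above_lt p z : ok z -> above p z -> lt Sy (pt p) (pt z).
Proof.
elim: z => [x|y IHy l x|y IHy q IHq l x] // okz /=.
  have yx : lt Sy (pt y) x by case: okz => _ h1 h2 _; apply: live_lt h1 h2.
  have oky := ok_prev okz; case: ifP => m; first by move=> /pre_lt; apply.
  by case=> [->//|/(IHy oky)/lt_trans]; apply.
have qx : lt Sy (pt q) x by case: okz => _ _ [h1 h2] _ _; apply: live_lt h1 h2.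
have okq := ok_par okz; case: ifP => m; first by move=> /pre_lt; apply.
by case=> [->//|/(IHq okq)/lt_trans]; apply.
Qed.

Lemma clab_live p z : ok z -> live Sy (pt p) (clab p z).
Proof.
elim: z => [x|y IHy l x|y IHy q IHq l x] okz /=; first exact: live_all.
  case: asboolP => [e|_] /=; first by subst p; case: okz.
  by case: ifP => _; [apply: IHy; apply: ok_prev okz|exact: live_all].
case: asboolP => [e|_] /=; first by subst p; case: okz => _ _ [].
case: ifP => _; last exact: live_all.
by case: ifP => _; [apply: IHy; apply: ok_prev okz|apply: IHq; apply: ok_par okz].
Qed.

Lemma clab_top p z : ok z -> pre z p -> clab p z = top p.
Proof.
elim: z => [x|y IHy l x|y IHy q IHq l x] okz //= zp.
  have yp : pre y p by apply: pre_trans zp; apply: (prev_pre (Fresh y l x)).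
  have [py|ny] := pselect (p = y); last first.
    by rewrite /=; case: asboolP => // _; rewrite IHy ?if_same//; apply: ok_prev okz.
  by subst p; have /pre_size[/(congr1 nsize)/eqP|] := zp; rewrite /= ?ltnNge ?leqnSn// eqn_leq ltnn.
have yp : pre y p by apply: pre_trans zp; apply: (prev_pre (Jump y q l x)).
have qy : pre q y by case: okz => oky /(above_preW oky).
have qp := pre_trans qy yp.
have [pq|nq] := pselect (p = q).
  by subst p; have /pre_size[/(congr1 nsize)/eqP|] := pre_trans zp qy;
    rewrite /= ?ltnNge ?leqnSn// eqn_leq ltnn.
by case: asboolP => // _; rewrite IHy ?IHq ?if_same//; [apply: ok_par okz|apply: ok_prev okz].
Qed.

(** This covers also a [z] that has jumped out of the successors of [p]: by M, successors of a link
    target are successors of its source, and J5 makes labels closed upwards. *)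
Lemma clab_weak p z x : fJ fl -> fM fl -> ok z -> pre p z -> p <> z ->
  lt Sy (pt z) x -> (clab p z).1 x.
Proof.
move=> j m; elim: z => [y|y IH l w|y IH q _ l w] okz /= [//|] // py _ wx.
  case: okz => oky h1 h2 _; case: asboolP => [e|ny]; first exact: live_up h1 h2 wx.
  by rewrite j; apply: IH => //; apply: lt_trans wx; apply: live_lt h1 h2.
case: okz => oky qy [h1 h2] yw _; case: asboolP => [e|nq]; first exact: live_up h1 h2 wx.
have yx := jmp_lt m yw wx; rewrite j m.
have [e|/IH] := pselect (p = y); last exact.
by subst p; rewrite clab_top//; apply: pre_refl.
Qed.

(** With M jumps keep the label, so the first node after [p] fixes it for the rest of the
    history. *)
Lemma clab_const p q z : fJ fl -> fM fl -> ok z -> pre p q -> p <> q -> pre q z ->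
  clab p z = clab p q.
Proof.
move=> j m; elim: z => [y|y IH l w|y IH q' _ l w] okz pq nq /= [->//|] // qy.
  rewrite j; case: asboolP => [e|_]; last by apply: IH => //; apply: ok_prev okz.
  by subst y; case: nq; apply: pre_anti.
rewrite j m; have IH' : clab p y = clab p q by apply: IH => //; apply: ok_prev okz.
by case: asboolP => [e|_//]; subst q'; case: okz => _ _ _ _ [_ _ -> //].
Qed.

Lemma clab_mem p z : ok z -> above p z -> (clab p z).1 (pt z).
Proof.
elim: z => [x|y IHy l x|y IHy q IHq l x] // okz /=.
  have lx : l.1 x by case: okz.
  have yx : lt Sy (pt y) x by case: okz => _ h1 h2 _; apply: live_lt h1 h2.
  have oky := ok_prev okz; case: asboolP => [e//|ny].
  case j: (fJ fl); last by move=> pz; exact: (@above_lt p _ okz pz).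
  case m: (fM fl); first by move=> py; apply: clab_weak yx.
  by case=> [//|py]; apply: live_up (clab_live p oky) (IHy oky py) yx.
have lx : l.1 x by case: okz => _ _ [].
have qx : lt Sy (pt q) x by case: okz => _ _ [h1 h2] _ _; apply: live_lt h1 h2.
have oky := ok_prev okz; have okq := ok_par okz; case: asboolP => [e//|nq].
case j: (fJ fl); last by move=> pz; exact: (@above_lt p _ okz pz).
case m: (fM fl).
  move=> pq; rewrite (@clab_const p q)//; first exact: clab_weak qx.
  by case: okz => _ /(above_preW oky).
by case=> [//|pq]; apply: live_up (clab_live p okq) (IHq okq pq) qx.
Qed.

Lemma pre_strict y l x p : ok (Fresh y l x) -> pre (Fresh y l x) p -> y <> p.
Proof.
move=> _ yp e; subst p; have /pre_size[/(congr1 nsize)/eqP|] := yp.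
  by rewrite /= eqn_leq ltnn.
by rewrite /= ltnNge leqnSn.
Qed.

(* A link out of a fresh successor of [p] cannot leave its label without leaving the
   successors of [p]. *)
Lemma clab_link p l0 x0 z (z0 := Fresh p l0 x0) : ok z -> link z0 z -> above p z ->
  (clab p z).1 `<=` l0.1.
Proof.
move=> okz lz pz; have okz0 := ok_pre okz (link_pre lz).
have own : (clab p z0).1 `<=` l0.1 by rewrite /z0 /=; case: asboolP => [_ ?|[]].
(* Without J5 links are chains of jumps, whose parents only move down the history; a target above
   [p] must then have [p] itself as its parent. *)
case j: (fJ fl); last first.
  have [pp] : pre (par z) p /\ (par z = p -> (clab p z).1 `<=` l0.1).
    clear pz; elim: z => [x|y IHy l x|y IHy q _ l x] in okz lz *.
    - by case: lz.
    - move: lz => [[<- <- <-]|[]]; last by rewrite j.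
      by split=> //; apply: pre_refl.
    - move: lz => [//|lz].
      have oky := ok_prev okz; have [py1 py2] := IHy oky lz.
      have qy : above q y by case: okz.
      have [qp _] := above_pre oky qy; split; first exact: pre_trans qp py1.
      move=> e; rewrite /= in e; subst q; rewrite /=; case: asboolP => // _.
      case: okz => _ _ _ _ [ly _ _ _ _]; apply: (subset_trans ly); apply: py2.
      exact: pre_anti.
  by apply; apply: pre_anti => //; case: (above_pre okz pz).
case m: (fM fl).
  clear pz; elim: z => [x|y IHy l x|y IHy q _ l x] in okz lz *; first by case: lz.
    move: lz => [[<- <- <-]//|[_ lz]] /=.
    have oky := ok_prev okz; case: asboolP => [e|_]; last by rewrite j; apply: IHy.
    by case: (pre_strict okz0 (link_pre lz)).
  move: lz => [//|lz] /=; have oky := ok_prev okz; rewrite j m.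
  case: asboolP => [e|_]; last exact: IHy.
  by subst q; case: okz => _ _ _ _ [_ _ -> // _ _]; apply: IHy.
(* With J5 and without M the label is inherited along parents. The parent [q] of a jump is above
   [p], hence not strictly before [z0] in the history. *)
elim: z => [x|y IHy l x|y IHy q IHq l x] in okz lz pz *; first by case: lz.
  move: lz => [[<- <- <-]//|[_ lz]] /=.
  have oky := ok_prev okz; case: asboolP => [e|ny].
    by case: (pre_strict okz0 (link_pre lz)).
  by rewrite j; apply: IHy => //; move: pz; rewrite /= m => -[].
move: lz => [//|lz] /=; have oky := ok_prev okz; have okq := ok_par okz; rewrite j m.
have qy : above q y by case: okz.
case: asboolP => [e|nq].
  by subst q; case: okz => _ _ _ _ [ly _ _ _ _]; apply: (subset_trans ly); apply: IHy.
have pq : above p q by move: pz; rewrite /= m => -[].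
apply: IHq => //; apply/link_preJ => //.
have [//|] := pre_total (link_pre lz) (above_preW oky qy).
move=> /pre_prev[->|qp]; first exact: pre_refl.
by case: nq; apply: pre_anti qp; apply: above_preW.
Qed.

Lemma jump_exists p u a b : ok u -> above p u -> (a ▷ b)%F \in Phi ->
  pt p (a ▷ b)%F -> pt u a ->
  exists t, [/\ ok t, above p t, link u t & pt t b].
Proof.
move=> oku pu Pab pab ua.
(* With P the jump is made for the parent of [u], to which [lt_rhd] passes [a ▷ b]; otherwise it is
   made for [p]. *)
have [q [qu pq qab hP]] : exists q, [/\ above q u, base p q, pt q (a ▷ b)%F &
    fP fl -> q = par u].
  case P: (fP fl); last first.
    by exists p; split=> //; rewrite /base; case: ifP => _; [exact: pre_refl|left].
  have [j /negbTE m] := PJ P.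
  have [e|pp] : p = par u \/ above p (par u).
      by case: (u) pu => [x|y l x|y q l x] //=; rewrite m.
    by exists p; split=> //; rewrite /base m; left.
  have up : above (par u) u by case: (u) pu => [x|y l x|y q l x] //=; rewrite m; left.
  exists (par u); split=> //; first by rewrite /base m; right.
  exact: lt_rhd P _ _ _ _ pab (above_lt (ok_par oku) pp).
have ul := clab_mem oku qu.
have [l' [z [[lv zl] [zb uz] [ll' /andP[n1 n2]] hM hW]]] :=
  live_jump Pab qab (clab_live q oku) ul ua.
(* For W, a parent of [u] other than [q] is in the same label and sees [u], so [live_jump] must have
   raised the counter. *)
have okt : ok (Jump u q l' z).
  split=> //; split=> //; first by rewrite n1.
  move=> w nq; have [j /negbTE m] := WJ w; have [//|/(_ (pt (par u)))] := hW w.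
  have qp : above q (par u).
    case: (u) qu nq => [x|y l x|y q' l x] //=; rewrite m; first by case=> [->|].
    by case=> [->|].
  have e : clab q u = clab q (par u).
    case: (u) qu nq => [x|y l x|y q' l x] //= _ nq.
      by rewrite j; case: asboolP => // e; rewrite e in nq.
    by rewrite j m; case: asboolP => // e; rewrite e in nq.
  move=> /(_ _ _)[]; first by rewrite e; apply: clab_mem => //; apply: ok_par.
  apply: par_lt => //.
  by case: (u) qu => [x|y l x|y q' l x] //=; rewrite m => _; left.
exists (Jump u q l' z); split=> //.
by right; apply: link_refl.
Qed.

Definition history_frame : frame :=
  @Frame {z : node | ok z} (fun x y => above (sval x) (sval y))
    (fun x y => link (sval x) (sval y)).

Definition history_val (n : nat) : set history_frame :=
  [set z | pt (sval z) (Var n)].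

Lemma truth (z : history_frame) a : a \in Phi ->
  sat history_val z a <-> pt (sval z) a.
Proof.
have [cN cA cO cI cB cR] := Phi_closed.
elim: a z => //=.
- by move=> z _; split=> // _; apply: wTop nL _.
- by move=> z _; split=> // /wBot.
- by move=> a IH z /cN Pa; rewrite IH// (wNot nL).
- by move=> a IHa b IHb z /cA[Pa Pb]; rewrite IHa// IHb// (wAnd nL).
- by move=> a IHa b IHb z /cO[Pa Pb]; rewrite IHa// IHb// (wOr nL).
- by move=> a IHa b IHb z /cI[Pa Pb]; rewrite IHa// IHb// (wImp nL).
- move=> a IH [z okz] /= Pa; split=> [h|za [y oky] /= zy]; last first.
    by apply/IH; [exact: cB|exact: lt_box (above_lt oky zy) Pa za].
  apply: contrapT => nza; have [x zx nxa] := lt_dia Sy Pa nza.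
  have oky : ok (Fresh z (top z) x) by split=> //; apply: live_all.
  apply: nxa; apply/(IH (exist _ _ oky)); first exact: cB.
  by apply: h => /=; case: ifP => _; [exact: pre_refl|left].
- move=> a IHa b IHb [z okz] /= Pab; have [Pa Pb] := cR _ _ Pab.
  split=> [h|zab [u oku] /= zu /(IHa _ Pa)/= ua]; last first.
    have [t [okt zt ut tb]] := jump_exists oku zu Pab zab ua.
    by exists (exist _ t okt); split=> //; apply/IHb.
  apply: contrapT => nz; have [G [x [lG Gx xa Gb]]] := live_need Sy Pab nz.
  have oky : ok (Fresh z (G, 0) x) by [].
  have [||[t okt] [/= zt yt /(IHb _ Pb)/= tb]] := h (exist _ _ oky).
  + by rewrite /=; case: ifP => _; [exact: pre_refl|left].
  + exact/IHa.
  + by apply: Gb tb; apply: clab_link okt yt zt _ (clab_mem okt zt).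
Qed.

Lemma history_CL : CL_frame history_frame.
Proof.
split.
- by move=> [x okx] [y oky] [z okz] /=; apply: above_trans.
- exists (fun x => rk Sy (pt (sval x))), (rk_max Sy) => -[x okx] [y oky] /= xy.
  exact: lt_rk (above_lt oky xy).
- by move=> [x okx]; apply: link_refl.
- by move=> [x okx] [y oky] [z okz] /=; apply: link_trans.
Qed.

Lemma history_J (x y : history_frame) : fJ fl -> acc x y -> lnk x y.
Proof.
by case: x y => [x okx] [y oky] /= j xy; apply/link_preJ => //; apply: above_preW.
Qed.

Lemma history_M (x y z : history_frame) : fM fl -> lnk x y -> acc y z -> acc x z.
Proof.
case: x y z => [x okx] [y oky] [z okz] /= m /link_pre xy.
by case: z okz => [w|q l w|q' q l w] //= _; rewrite m; apply: pre_trans.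
Qed.

(** A jump keeps the parent of its source, so no ancestor is lost along links. *)
Lemma history_P (x y z : history_frame) : fP fl -> acc x y -> lnk y z -> acc x z.
Proof.
case: x y z => [x okx] [y oky] [z okz] /= P xy; have [j /negbTE m] := PJ P.
elim: z okz => [w|q IH l w|q' IHq' q IHq l w] okz /=.
- by case=> // e; subst y.
- case=> [e|[_ qy]]; first by subst y.
  by rewrite m; right; apply: IH => //; apply: ok_prev okz.
- case=> [e|yq]; first by subst y.
  have := IHq' (ok_prev okz) yq.
  case: okz => _ _ _ _ [_ _ _ /(_ P) -> _].
  by case: (q') => [v|v l' v'|v v' l' v''] //=; rewrite m.
Qed.

(** * A bounded measure for W *)

Section Measure.

Hypothesis fWt : fW fl.

Let j : fJ fl. Proof. by case: (WJ fWt). Qed.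
Let m : fM fl = false. Proof. by case: (WJ fWt) => _ /negbTE. Qed.

Fixpoint dep (z : node) : nat :=
  match z with
  | Root _ => 0 | Fresh y _ _ => (dep y).+1 | Jump _ q _ _ => (dep q).+1
  end.

Let D := rk_max Sy.
(** A base exceeding the digits [l.2.+1], which are shifted by one so that longer chains count
    more. *)
Let K := (lab_max Sy).+2.

(* The counters of the labels along the chain of parents, compared lexicographically. *)
Fixpoint mu (z : node) : nat :=
  match z with
  | Root _ => 0
  | Fresh q l _ | Jump _ q l _ => mu q + l.2.+1 * K ^ (D - (dep q).+1)
  end.

Let Kgt0 n : 0 < K ^ n. Proof. by rewrite expn_gt0. Qed.

Lemma dep_rk z : ok z -> dep z <= rk Sy (pt z).
Proof.
elim: z => [x|y IHy l x|y IHy q IHq l x] //= okz.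
  have /lt_rk/andP[h _] : lt Sy (pt y) x by case: okz => _ h1 h2 _; apply: live_lt h1 h2.
  by apply: leq_ltn_trans h; apply: IHy; case: okz.
have /lt_rk/andP[h _] : lt Sy (pt q) x
  by case: okz => _ _ [h1 h2] _ _; apply: live_lt h1 h2.
by apply: leq_ltn_trans h; apply: IHq; apply: (@ok_par (Jump y q l x)).
Qed.

(** [K ^ (D - dep z)] is the room left for digits above [z]; one digit and its room fit into the
    room of the parent. *)
Lemma mu_par z q : ok z -> above q z ->
  mu z + K ^ (D - dep z) <= mu (par z) + K ^ (D - dep (par z)) /\ mu (par z) < mu z.
Proof.
move=> okz qz.
have step (n k : nat) : k <= lab_max Sy -> n < D ->
    k.+1 * K ^ (D - n.+1) + K ^ (D - n.+1) <= K ^ (D - n) /\ 0 < k.+1 * K ^ (D - n.+1).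
  move=> kK nD; split; last by rewrite muln_gt0 Kgt0.
  by rewrite -mulSnr -[D - n]prednK ?subn_gt0// -subnS expnS leq_mul2r; apply/orP; right.
have par_D : dep (par z) < D.
  have pz : above (par z) z.
    by case: (z) qz => [x|y l x|y p l x] //=; rewrite m => _; left.
  have /lt_rk/andP[h1 h2] := par_lt okz pz.
  by apply: leq_trans h2; apply: leq_ltn_trans h1; apply: dep_rk; apply: ok_par.
case: z okz qz par_D => [x|y l x|y p l x] //= okz qz pD.
  have kl : l.2 <= lab_max Sy by case: okz => _ _ _ ->.
  have [h1 h2] := step _ _ kl pD.
  by rewrite -addnA leq_add2l -{1}[mu y]addn0 ltn_add2l.
have kl : l.2 <= lab_max Sy by case: okz => _ _ _ _ [_ /andP[]].
have [h1 h2] := step _ _ kl pD.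
by rewrite -addnA leq_add2l -{1}[mu p]addn0 ltn_add2l.
Qed.

(** [clab q z] is the label at the child of [q] on the chain of parents of [z], so its counter gives
    the first digit after those of [q]. *)
Lemma mu_above q z : ok z -> above q z ->
  mu z < mu q + (clab q z).2.+2 * K ^ (D - (dep q).+1) /\ mu q < mu z.
Proof.
move=> okz qz.
suff [h1 h2] : mu z + K ^ (D - dep z) <= mu q + (clab q z).2.+2 * K ^ (D - (dep q).+1)
    /\ mu q < mu z.
  by split=> //; apply: leq_trans h1; rewrite -{1}[mu z]addn0 ltn_add2l.
elim: z => [x|y IHy l x|y IHy p IHp l x] // in okz qz *.
  have [h1 h2] := mu_par okz qz.
  rewrite /=; case: asboolP => [e|nq].
    by subst y; split=> //; rewrite -addnA -mulSnr.
  rewrite j; have qy : above q y by move: qz; rewrite /= m => -[].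
  have [h3 h4] := IHy (ok_prev okz) qy.
  by split; [apply: leq_trans h1 h3|apply: ltn_trans h4 h2].
have [h1 h2] := mu_par okz qz.
rewrite /=; case: asboolP => [e|nq].
  by subst p; split=> //; rewrite -addnA -mulSnr.
rewrite j m; have qp : above q p by move: qz; rewrite /= m => -[].
have [h3 h4] := IHp (ok_par okz) qp.
by split; [apply: leq_trans h1 h3|apply: ltn_trans h4 h2].
Qed.

Lemma mu_link y z : ok z -> link y z -> mu y <= mu z.
Proof.
elim: z => [x|q IH l x|u IH q _ l x] okz [->|] //.
  case=> _ /(IH (ok_prev okz))/leq_trans; apply; rewrite ltnW//.
  by have [|_ h] := @mu_par _ q okz; first by rewrite /= m; left.
move=> /(IH (ok_prev okz))/leq_trans; apply.
have oku := ok_prev okz; have qu : above q u by case: okz.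
case: okz => _ _ _ _ [_ /andP[n1 n2] _ _ /(_ fWt) hW] /=.
(* Either the last digit is replaced by one that is not smaller, or a strictly larger digit
   outweighs all that came above [q]. *)
have [e|/hW {}n1] := pselect (par u = q); last first.
  have [h _] := mu_above oku qu; apply: leq_trans (ltnW h) _.
  by rewrite leq_add2l leq_mul2r ltnS n1 orbT.
have -> : mu u = mu q + (clab q u).2.+1 * K ^ (D - (dep q).+1).
  by subst q; case: (u) qu => [w|w k v|w w' k v] //= _; case: asboolP.
by rewrite leq_add2l leq_mul2r ltnS n1 orbT.
Qed.

Lemma history_W : exists (f : history_frame -> nat) N, [/\ forall x, f x <= N,
  forall x y, acc x y -> f x < f y & forall x y, lnk x y -> f x <= f y].
Proof.
exists (fun x => mu (sval x)), (K ^ D); split.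
- move=> [z okz] /=.
  suff h : mu z + K ^ (D - dep z) <= K ^ D by apply: leq_trans h; apply: leq_addr.
  elim: z => [x|y IHy l x|y IHy p IHp l x] in okz *; first by rewrite /= subn0.
    have [|h1 _] := @mu_par _ y okz; first by rewrite /= m; left.
    by apply: leq_trans h1 _; apply: IHy; apply: ok_prev okz.
  have [|h1 _] := @mu_par _ p okz; first by rewrite /= m; left.
  by apply: leq_trans h1 _; apply: IHp; apply: ok_par okz.
- by move=> [x okx] [y oky] /= /(mu_above oky)[].
- by move=> [x okx] [y oky] /=; apply: mu_link.
Qed.

End Measure.

End Histories.

(** * Logics with J5 *)

Section Gain.

Variables (L : set formula) (Th : seq formula).
Hypothesis nL : normal L.

Definition gain (x y : mcs L) := exists2 t, t \in Th & y (□ t)%F /\ ~ x (□ t)%F.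

Definition brank (x : mcs L) := count (fun t => `[< x (□ t)%F >]) Th.

Lemma gain_rank x y : incl x y -> gain x y -> brank x < brank y <= size Th.
Proof.
move=> xy [t tTh [yt nxt]]; rewrite count_size andbT /brank.
have {tTh} := tTh; elim: Th => //= u s IH; rewrite inE => /orP[/eqP<-|/IH h].
  rewrite asboolF// asboolT// add0n add1n ltnS; apply: sub_count => c.
  by move=> /asboolP/xy/asboolP.
rewrite -addnS leq_add//; case: asboolP => // /xy xu.
by rewrite asboolT.
Qed.

Lemma gain_inclr x y z : gain x y -> incl y z -> gain x z.
Proof. by move=> [t tTh [yt nxt]] yz; exists t => //; split=> //; apply: yz. Qed.

Lemma gain_incll x y z : incl x y -> gain y z -> gain x z.
Proof. by move=> xy [t tTh [zt nyt]]; exists t => //; split=> // /xy. Qed.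

Lemma gain_not (x y : mcs L) a : (~~ a)%F \in Th -> prec x y -> y a -> y (□ ~~ a)%F ->
  gain x y.
Proof.
move=> aTh xy ya yNa; exists (~~ a)%F => //; split=> // /xy.
by move/(wNot nL).
Qed.

End Gain.

Section J5Systems.

Variables (L : set formula) (Phi : seq formula) (m P w : bool).
Hypothesis nL : normal L.
Hypothesis J5L : L axJ5.
Hypothesis ML : m -> L axM.
Hypothesis PL : P -> L axP.
Hypothesis WL : w -> L axW.
Hypothesis wm : w -> ~~ m.
Hypothesis cPhi : sub_closed Phi.

(** The formulas whose boxes count as new: members of [Phi] for refuted boxes, negations for
    Löb-minimal witnesses. *)
Let Th := Phi ++ map Not Phi.

Let ThN a : a \in Phi -> (~~ a)%F \in Th.
Proof. by move=> Pa; rewrite mem_cat map_f ?orbT. Qed.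

(** By J5 and J2, [e ▷ d] gives [◇ e ▷ d], so [x] avoids [◇ e] too. *)
Lemma crit_up (p x y : mcs L) d : crit p d x -> prec x y -> crit p d y.
Proof.
move=> cx xy e pe; apply/(wNot nL)/xy; apply: contrapT => nx.
apply: (cx (◇ e)%F); last exact/(wNot nL).
apply: (rhd_trans nL (wL p (@ax3 _ nL _ e e e J5L)) pe).
Qed.

(** By Löb a world with [a] satisfies [c] or [◇ c], and J5 leads from [◇ c] to [c]. *)
Lemma rhd_minimal (p : mcs L) a b :
  p ((a && □ ~~ a) ▷ b)%F -> p (a ▷ b)%F.
Proof.
move=> h; set c := (a && _)%F in h.
apply: (rhd_trans nL _ (rhd_or nL h (rhd_trans nL (wL p (@ax3 _ nL _ c c c J5L)) h))).
apply: (rhd_box nL) => y _ ya; apply/(wOr nL).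
have [yN|nyN] := pselect (y (□ ~~ a)%F); first by left; apply/(wAnd nL).
right; apply/(wNot nL) => yc; apply: nyN; apply: (wLoeb nL).
apply/(boxP nL) => z yz; apply/(wImp nL) => zN; apply/(wNot nL) => za.
by have /(wNot nL) := yz _ yc; apply; apply/(wAnd nL).
Qed.

Definition lt5 (x y : mcs L) := prec x y /\ gain Th x y.

Lemma crit_minimal (p : mcs L) a d : a \in Phi -> ~ p (a ▷ d)%F ->
  exists x, [/\ crit p d x, lt5 p x & x a].
Proof.
move=> Pa nad; have [|x [cx /(wAnd nL)[xa xN]]] := @crit_exists _ nL p (a && □ ~~ a)%F d.
  by move=> /rhd_minimal.
exists x; split=> //; split; first exact: crit_prec cx.
exact: (gain_not nL (ThN Pa) (crit_prec nL cx)).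
Qed.

(* With W, a link made on account of [a |> _] adds [◇ a] to the formulas to be avoided. *)
Definition avoid (d : formula) (s : seq formula) : formula :=
  foldr (fun a r => (◇ a || r)%F) d s.

(** [s] lists the antecedents for which W has narrowed the label; free of duplicates and inside
    [Phi], it bounds the counter. *)
Definition live5 (p : mcs L) (l : set (mcs L) * nat) :=
  exists d s, [/\ uniq s, {subset s <= Phi}, l.2 = size s, w \/ s = [::] &
    l.1 = [set x | crit p (avoid d s) x /\ lt5 p x]].

Lemma avoidP (x : mcs L) d s a : a \in s -> x (◇ a)%F -> x (avoid d s).
Proof.
elim: s => //= b s IH; rewrite inE => /orP[/eqP<-|/IH h] xa; apply/(wOr nL); first by left.
by right; apply: h.
Qed.

Lemma live5_jump (p : mcs L) l (x : mcs L) a b : (a ▷ b)%F \in Phi ->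
  p (a ▷ b)%F -> live5 p l -> l.1 x -> x a -> exists l' (z : mcs L),
    [/\ live5 p l' /\ l'.1 z, z b /\ (m -> incl x z),
        l'.1 `<=` l.1 /\ l.2 <= l'.2 <= size Phi,
        m -> l' = l & w -> l.2 < l'.2 \/ forall c, l.1 c -> ~ lt5 c x].
Proof.
move=> Pab pab lv lx xa; have [d [s [us sPhi ls ws lE]]] := lv.
have [Pa Pb] := closedR cPhi Pab.
have [cx px] : crit p (avoid d s) x /\ lt5 p x by move: lx; rewrite lE.
have ss : size s <= size Phi by apply: uniq_leq_size.
have nbd : ~ p (b ▷ avoid d s)%F := crit_jump nL pab cx xa.
(* With M the witness keeps all boxes of [x], including the one that is new over [p], so the label
   can stay. *)
have [mT|/negP nm] := boolP m.
  have [z [cz zb xz]] := crit_jumpM nL (ML mT) pab cx xa.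
  exists l, z; split=> //; last by move=> /wm; rewrite mT.
  - split=> //; rewrite lE; split=> //; split; first exact: crit_prec cz.
    exact: gain_inclr px.2 xz.
  - by split=> //; rewrite leqnn ls.
(* The label also stays without W or if [a] is already in [s]. In the latter case no member of the
   label sees [x]: it would satisfy [◇ a], which is avoided. *)
have [wa|nwa] := pselect (w /\ a \notin s); last first.
  have [z [cz pz zb]] := crit_minimal Pb nbd.
  exists l, z; split=> //; first by rewrite lE.
  - by split=> //; rewrite leqnn ls.
  move=> wT; right=> c; rewrite lE => -[cc _] [cx' _].
  have sa : a \in s by apply: contrapT => /negP na; apply: nwa.
  have ca : c (◇ a)%F by apply/(wNot nL) => /cx' /(wNot nL); apply.
  by apply: (cc (◇ a)%F) => //; apply: (rhd_box nL) => y _; apply: avoidP.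
have [wT na] := wa.
(* Otherwise [a ▷ (◇ a || avoid d s)] would hold, and W would turn it into [a ▷ avoid d s], since
   [□ ~~ a] excludes the first disjunct. *)
have [|z [cz pz zb]] := @crit_minimal p b (avoid d (a :: s)) Pb.
  move=> bd; have ad := rhd_trans nL pab bd.
  have := wL p (@ax3 _ nL _ a (avoid d (a :: s)) a (WL wT)) => /(wImp nL)/(_ ad) h.
  apply: cx xa; apply: (rhd_trans nL h); apply: (rhd_box nL) => y _.
  by move=> /(wAnd nL)[/(wOr nL)[/(wNot nL) h1 h2|//]].
exists ([set x | crit p (avoid d (a :: s)) x /\ lt5 p x], (size s).+1), z; split=> //.
- split=> //; exists d, (a :: s); split=> //; [by rewrite /= na|..| by left].
  by move=> c; rewrite inE => /orP[/eqP->|/sPhi].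
- split; last by rewrite ls leqnSn; apply: (@uniq_leq_size _ (a :: s));
    [rewrite /= na|move=> c; rewrite inE => /orP[/eqP->|/sPhi]].
  rewrite lE => y [cy py]; split=> // e pe; apply: cy.
  by apply: (rhd_trans nL pe); apply: (rhd_box nL) => u _ ud; apply/(wOr nL); right.
- by move=> _; left; rewrite ls.
Qed.

Definition flags5 := Flags true m P w.

Lemma system5 : system L Phi flags5.
Proof.
have ltE (x y : mcs L) : lt5 x y -> incl x y by case=> /(prec_incl nL).
have liveP p l x : live5 p l -> l.1 x -> lt5 p x.
  by move=> [d [s [_ _ _ _ ->]]] [].
refine (@System L Phi flags5 lt5 (fun x y => m -> incl x y) live5 (@brank L Th)
  (size Th) (size Phi) _ _ _ _ _ _ _ _ _ _ _).
- move=> x y z [xy gxy] [yz _]; split; first exact: prec_trans xy yz.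
  exact: gain_inclr gxy (prec_incl nL yz).
- by move=> x y a [xy _] _; apply: xy.
- by move=> x y xy; apply: gain_rank (ltE _ _ xy) _; case: xy.
- move=> x a Pa nxa; have [y [xy yNa]] : exists y, prec x y /\ y (~~ a)%F.
    apply: contrapT => ny; apply: nxa; apply/(boxP nL) => y xy.
    by apply: contrapT => /(wNot nL) ya; apply: ny; exists y.
  have [z [xz zNa zNN]] := loeb_world nL xy yNa.
  exists z; last exact/(wNot nL).
  split=> //; exists a; first by rewrite mem_cat (closedB cPhi Pa).
  by split=> //; apply: box_mono zNN => // u /(wNot nL) h; apply: contrapT => /(wNot nL).
- by move=> /= mT x y z /(_ mT) xy [yz gyz]; split; [exact: incl_prec xy yz|exact: gain_incll xy gyz].
- exact: liveP.
- move=> _ p l x y [d [s [_ _ _ _ ->]]] /= [cx px] xy; split.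
    by apply: crit_up cx _; case: xy.
  case: px => px gx; case: xy => xy _; split; first exact: prec_trans px xy.
  exact: gain_inclr gx (prec_incl nL xy).
- move=> p; exists ⊥%F, [::]; split=> //; first by right.
  apply/seteqP; split=> x /=; last by case.
  by move=> px; split=> //; apply/(crit_bot nL); case: px.
- move=> p a b Pab nab; have [Pa Pb] := closedR cPhi Pab.
  have [x [cx px xa]] := crit_minimal Pa nab.
  exists [set x | crit p b x /\ lt5 p x], x; split=> //.
    by exists b, [::]; split=> //; right.
  by move=> y [/(crit_self nL)].
- exact: live5_jump.
- move=> /= PT x y a b xab [xy _]; apply: xy.
  by have /(wImp nL) := wL x (@ax3 _ nL _ a b a (PL PT)); apply.
Qed.

End J5Systems.

(** * Logics without J5 *)

Fixpoint types (Phi : seq formula) : seq formula :=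
  match Phi with
  | [::] => [:: ⊤%F]
  | a :: Ph => [seq (a && c)%F | c <- types Ph] ++ [seq (~~ a && c)%F | c <- types Ph]
  end.

Definition somebox (s : seq formula) : formula :=
  foldr (fun c r => (□ ~~ c || r)%F) ⊥%F s.

Fixpoint sublists (s : seq formula) : seq (seq formula) :=
  match s with
  | [::] => [:: [::]]
  | c :: s' => map (cons c) (sublists s') ++ sublists s'
  end.

Lemma mem_sublists (p : pred formula) s : [seq c <- s | p c] \in sublists s.
Proof.
elim: s => //= c s IH; rewrite mem_cat; case: ifP => _; last by rewrite IH orbT.
by rewrite map_f.
Qed.

Section Types.

Variable L : set formula.
Hypothesis nL : normal L.

Definition agree (Phi : seq formula) (x y : mcs L) :=
  forall a, a \in Phi -> x a <-> y a.

Lemma type_exists Phi (x : mcs L) : exists2 c, c \in types Phi & x c.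
Proof.
elim: Phi => [|a Ph [c cT xc]]; first by exists ⊤%F; [rewrite inE|exact: wTop].
have [xa|nxa] := pselect (x a).
  exists (a && c)%F; last exact/(wAnd nL).
  by rewrite mem_cat map_f.
exists (~~ a && c)%F; first by rewrite mem_cat map_f ?orbT.
by apply/(wAnd nL); split=> //; apply/(wNot nL).
Qed.

Lemma type_agree Phi c (x y : mcs L) : c \in types Phi -> x c -> y c -> agree Phi x y.
Proof.
elim: Phi c => // a Ph IH c; rewrite mem_cat => /orP[] /mapP[e eT ->].
  move=> /(wAnd nL)[xa xe] /(wAnd nL)[ya ye] b; rewrite inE => /orP[/eqP->//|].
  exact: IH xe ye b.
move=> /(wAnd nL)[/(wNot nL) xa xe] /(wAnd nL)[/(wNot nL) ya ye] b.
by rewrite inE => /orP[/eqP->//|]; apply: IH xe ye b.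
Qed.

Lemma someboxP (x : mcs L) s : x (somebox s) <-> exists2 c, c \in s & x (□ ~~ c)%F.
Proof.
elim: s => [|c s IH] /=; first by split=> [/wBot|[]].
rewrite (wOr nL) IH; split=> [[xc|[e es xe]]|[e]].
- by exists c; rewrite ?inE ?eqxx.
- by exists e; rewrite ?inE ?es ?orbT.
- by rewrite inE => /orP[/eqP->|es xe]; [left|right; exists e].
Qed.

Lemma somebox_incl (x y : mcs L) s : incl x y -> x (somebox s) -> y (somebox s).
Proof. by move=> xy /someboxP[c cs xc]; apply/someboxP; exists c => //; apply: xy. Qed.

End Types.

Lemma subst_comp s t a : subst s (subst t a) = subst (fun n => subst s (t n)) a.
Proof. by elim: a => //= [a ->|a -> b ->|a -> b ->|a -> b ->|a ->|a -> b ->]. Qed.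

Lemma beval_subst w s a :
  beval w (subst s a) = beval (fun b => if b is Var n then beval w (s n) else w (subst s b)) a.
Proof. by elim: a => //= [a ->|a -> b ->|a -> b ->|a -> b ->]. Qed.

(* A world of CLM with a prescribed [Phi]-type and the smallest possible set of boxes: the
   theory of a new root below the worlds [z] with [v R z] and [z |= o], together with
   copies of them labelled by the formulas they have to avoid. *)
Section VirtualRoot.

Notation W := (mcs CLM).
Hypothesis nL : normal CLM.
Hypothesis LM : CLM axM.

Variables (Phi : seq formula) (v y : W) (o : formula).
Hypothesis cPhi : sub_closed Phi.
Hypothesis vy : agree Phi v y.
Hypothesis ivy : incl v y.
Hypothesis yo : y (□ o)%F.
Hypothesis o_incl : forall x z : W, incl x z -> x o -> z o.

Definition vpt (k : W * option formula) : Prop :=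
  match k.2 with None => prec v k.1 /\ k.1 o | Some d => crit y d k.1 end.

Definition vlnk (k k' : W * option formula) : Prop := k.2 = k'.2 /\ incl k.1 k'.1.

Fixpoint vsat (a : formula) : Prop :=
  match a with
  | Var n => v (Var n)
  | Top => True
  | Bot => False
  | Not b => ~ vsat b
  | And b c => vsat b /\ vsat c
  | Or b c => vsat b \/ vsat c
  | Imp b c => vsat b -> vsat c
  | Box b => forall k, vpt k -> k.1 b
  | Rhd b c => forall k, vpt k -> k.1 b -> exists k', [/\ vpt k', vlnk k k' & k'.1 c]
  end.

Lemma vpt_prec k z : vpt k -> prec k.1 z -> vpt (z, None).
Proof.
case: k => x [d|] /=; rewrite /vpt /=.
  move=> /(crit_prec nL) yx xz; have yz := prec_trans nL yx xz.
  by split; [exact: incl_prec ivy yz|exact: yz].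
by move=> [vx xo] xz; split; [exact: prec_trans vx xz|exact: o_incl (prec_incl nL xz) xo].
Qed.

Lemma vsat_beval a : vsat a <-> beval (fun b => `[<vsat b>]) a.
Proof.
elim: a => /=.
- by move=> n; split=> [/asboolP|/asboolP].
- by [].
- by [].
- by move=> a IH; rewrite IH; split=> /negP.
- by move=> a IHa b IHb; rewrite IHa IHb; split=> /andP.
- by move=> a IHa b IHb; rewrite IHa IHb; split=> /orP.
- by move=> a IHa b IHb; rewrite IHa IHb; split=> /implyP.
- by move=> a _; split=> [/asboolP|/asboolP].
- by move=> a _ b _; split=> [/asboolP|/asboolP].
Qed.

Lemma vsat_sound : CLM `<=` vsat.
Proof.
(* [vsat] evaluates at the root alone. At the other points truth is membership, and necessitation
   therefore uses that [a] is a theorem. *)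
pose T := [set a | CLM a /\ forall s, vsat (subst s a)].
have T_closed : closed_under_rules T.
  split.
  - move=> a b [Lab hab] [La ha]; split; first exact: (nmp nL) Lab La.
    by move=> s; apply: hab (ha s).
  - move=> a [La ha]; split; first exact: (nnec nL).
    by move=> s k _; apply: wL; apply: (nsub nL).
  - move=> s a [La ha]; split; first exact: (nsub nL).
    by move=> t; rewrite subst_comp.
suff sub : CLM `<=` T.
  move=> a /sub[_ /(_ Var)]; suff -> : subst Var a = a by [].
  by elim: a => //= [a ->|a -> b ->|a -> b ->|a -> b ->|a ->|a -> b ->].
have CLT : CL `<=` T.
  have tautT : tautology `<=` T.
    move=> a ta; split; first exact: (ntaut nL).
    by move=> s; apply/vsat_beval; rewrite beval_subst; apply: ta.
  apply: smallest_sub => //; rewrite subUset; split=> // a axa.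
  split; first exact: (nax nL).
  move: axa => [[[[[->|->]|->]|->]|->]|->] s /=.
  - by move=> hab ha k kp; have /(wImp nL) hk := hab k kp; apply: hk; apply: ha.
  (* Löb's scheme is applied in the world of [k], whose successors all occur as unlabelled
     points. *)
  - move=> h k kp; have /(wImp nL) hk := h k kp; apply: hk.
    apply: (wLoeb nL); apply/(boxP nL) => z kz.
    exact: (h (z, None) (vpt_prec kp kz)).
  - move=> h k kp ka; exists k; split=> //; first by split=> // c.
    by have /(wImp nL) hk := h k kp; apply: hk.
  - move=> [hab hbc] k kp /(hab _ kp)[k' [kp' [e1 i1] /(hbc _ kp')[k'' [kp'' [e2 i2] kc]]]].
    exists k''; split=> //; split; first by rewrite e1.
    exact: incl_trans i1 i2.
  - by move=> [hac hbc] k kp /(wOr nL)[/(hac _ kp)|/(hbc _ kp)].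
  - move=> hab nNa Nb; apply: nNa => k kp; apply/(wNot nL) => /(hab _ kp)[k' [kp' _ kb]].
    by move: (Nb _ kp') => /(wNot nL).
apply: smallest_sub => //; rewrite subUset; split=> // _ ->; split=> // s /=.
move=> hab k kp /(wAnd nL)[ka kc]; have [k' [kp' [e i] kb]] := hab _ kp ka.
by exists k'; split=> //; apply/(wAnd nL); split=> //; apply: i.
Qed.

Lemma vsat_theory : theory CLM vsat.
Proof. by split; [exact: vsat_sound|move=> a b /= h /h|]. Qed.

Definition vroot : W := Mcs vsat_theory (fun a => EM (vsat a)).

(** A refuted [a ▷ b] stays refuted by a copy labelled [b], as links keep the label. A true one
    survives since [crit_jumpM] finds targets that keep all boxes, and with them [o]. *)
Lemma vroot_agree : agree Phi vroot v.
Proof.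
have [cN cA cO cI cB cR] := cPhi.
elim=> //=.
- by move=> _; split=> // _; apply: wTop.
- by move=> _; split=> // /wBot.
- by move=> a IH /cN Pa; rewrite (wNot nL) -IH.
- by move=> a IHa b IHb /cA[Pa Pb]; rewrite (wAnd nL) -IHa// -IHb.
- by move=> a IHa b IHb /cO[Pa Pb]; rewrite (wOr nL) -IHa// -IHb.
- by move=> a IHa b IHb /cI[Pa Pb]; rewrite (wImp nL) -IHa// -IHb.
- move=> a _ Pa; split=> [h|va [z [d|]] /=]; rewrite /vpt /=; last first.
  + by move=> [vz _]; apply: vz.
  + by move=> /(crit_prec nL); apply; apply/(vy Pa).
  apply/(vy Pa)/(boxP nL) => z yz.
  by apply: (h (z, Some ⊥%F)); apply/(crit_bot nL).
- move=> a _ b _ Pab; split=> [h|vab].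
    apply: contrapT => nab; have [x [cx xa]] := crit_exists nL (fun h => nab ((vy Pab).2 h)).
    have [[x' d] [cx' [/= e i]]] := h (x, Some b) cx xa.
    by move: cx'; rewrite -e /vpt /= => /(crit_self nL).
  move=> [z [d|]]; rewrite /vpt /=.
    move=> cz za; have [x [cx xb zx]] := crit_jumpM nL LM ((vy Pab).1 vab) cz za.
    by exists (x, Some d).
  move=> [vz zo] za.
  have [x [cx xb zx]] := crit_jumpM nL LM vab ((crit_bot nL _ _).2 vz) za.
  exists (x, None); split=> //; split; first exact: crit_prec cx.
  exact: o_incl zx zo.
Qed.

(** By [ivy] and [yo] the worlds of the labelled copies also lie above [v] and satisfy [o]. *)
Lemma vroot_box a : vroot (□ a)%F <-> forall z : W, prec v z -> z o -> z a.
Proof.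
split=> [h z vz zo|h [z [d|]]]; first exact: (h (z, None)).
  rewrite /vpt /= => /(crit_prec nL) yz; apply: h; first exact: incl_prec ivy yz.
  exact: yz.
by rewrite /vpt /= => -[]; apply: h.
Qed.

End VirtualRoot.

Section CLSystems.

Variables (L : set formula) (Phi : seq formula) (m : bool).
Hypothesis nL : normal L.
Hypothesis ML : m -> L axM.
Hypothesis cPhi : sub_closed Phi.

(** Negated types serve the Löb-minimal worlds of a type, and the [somebox] formulas serve as [o]
    for virtual roots. *)
Let Th := Phi ++ map Not Phi ++ map Not (types Phi) ++ map somebox (sublists (types Phi)).

(* A successor [x] of [p] need not contain all [a] with [□ a] in [p]: it suffices that it
   can be mistaken for a genuine successor [y] with the same [Phi]-type and more boxes. *)
Definition lt0 (p x : mcs L) :=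
  [/\ incl p x, exists y, [/\ agree Phi x y, prec p y & incl x y] & gain Th p x].

Definition live0 (p : mcs L) (l : set (mcs L) * nat) :=
  [/\ l.2 = 0, forall x, l.1 x -> lt0 p x &
   forall a b (x : mcs L), (a ▷ b)%F \in Phi -> p (a ▷ b)%F -> l.1 x -> x a ->
     exists z : mcs L, [/\ l.1 z, z b & m -> incl x z]].

Definition needs0 := forall (p : mcs L) a b, (a ▷ b)%F \in Phi -> ~ p (a ▷ b)%F ->
  exists (G : set (mcs L)) (x : mcs L),
    [/\ live0 p (G, 0), G x, x a & forall y : mcs L, G y -> ~ y b].

Lemma lt0_prec (p x : mcs L) : prec p x -> gain Th p x -> lt0 p x.
Proof. by move=> px gx; split=> //; [exact: prec_incl|exists x; split]. Qed.

Lemma lt0_minimal (p x : mcs L) a : a \in Phi -> prec p x -> x a ->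
  exists2 z : mcs L, lt0 p z & z a.
Proof.
move=> Pa px xa; have [z [pz za zN]] := loeb_world nL px xa.
exists z => //; apply: (lt0_prec pz); apply: (gain_not nL _ pz za zN).
by rewrite !mem_cat map_f ?orbT.
Qed.

Lemma live0_all (p : mcs L) : live0 p ([set x | lt0 p x], 0).
Proof.
split=> // a b x Pab pab /= [px [y [xy py ixy]] gx] xa.
have [Pa Pb] := closedR cPhi Pab; have ya := (xy _ Pa).1 xa.
have [mT|nm] := boolP m.
  have [z [/(crit_prec nL) pz zb yz]] := crit_jumpM nL (ML mT) pab ((crit_bot nL _ _).2 py) ya.
  exists z; split=> //; last by move=> _; apply: incl_trans ixy yz.
  apply: (lt0_prec pz); apply: gain_inclr gx _; exact: incl_trans ixy yz.
have [u pu ub] := rhd_dia nL pab py ya.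
by have [z pz zb] := lt0_minimal Pb pu ub; exists z; split=> //; rewrite (negbTE nm).
Qed.

Lemma system0 : needs0 -> system L Phi (Flags false m false false).
Proof.
move=> needs.
have ltI (x y : mcs L) : lt0 x y -> incl x y by case.
refine (@System L Phi (Flags false m false false) lt0 (fun x y => m -> incl x y) live0
  (@brank L Th) (size Th) 0 _ _ _ _ _ _ _ live0_all _ _ _) => //.
- move=> x y z [xy _ gxy] [yz [u [zu yu izu]] _]; split; first exact: incl_trans xy yz.
    by exists u; split=> //; apply: incl_prec xy yu.
  exact: gain_inclr gxy yz.
- move=> x y a [xy [u [yu xu iyu]] _] Pa xa; apply/(yu _ (closedB cPhi Pa)).
  exact: xu.
- by move=> x y xy; apply: gain_rank (ltI _ _ xy) _; case: xy.
- move=> x a Pa nxa; have [y [xy yNa]] : exists y, prec x y /\ y (~~ a)%F.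
    apply: contrapT => ny; apply: nxa; apply/(boxP nL) => y xy.
    by apply: contrapT => /(wNot nL) ya; apply: ny; exists y.
  have [z [xz zNa zNN]] := loeb_world nL xy yNa.
  exists z; last exact/(wNot nL).
  apply: (lt0_prec xz); exists a; first by rewrite mem_cat (closedB cPhi Pa).
  by split=> //; apply: box_mono zNN => // u /(wNot nL) h; apply: contrapT => /(wNot nL).
- move=> /= mT x y z /(_ mT) xy [yz [u [zu yu izu]] gyz]; split.
  + exact: incl_trans xy yz.
  + by exists u; split=> //; apply: incl_prec xy yu.
  + exact: gain_incll xy gyz.
- by move=> p l x [_ h _]; apply: h.
- move=> p l x a b Pab pab lv lx xa; have [l0 ll lj] := lv.
  have [z [lz zb xz]] := lj _ _ _ Pab pab lx xa.
  by exists l, z; split=> //; split=> //; rewrite l0.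
Qed.

Lemma types_gain (p x : mcs L) c : c \in types Phi -> prec p x -> x c -> x (□ ~~ c)%F ->
  gain Th p x.
Proof. by move=> cT; apply: (gain_not nL); rewrite !mem_cat (map_f Not cT) !orbT. Qed.

Lemma somebox_gain (p x : mcs L) (f : pred formula) (s := somebox [seq c <- types Phi | f c]) :
  x (□ s)%F -> ~ p (□ s)%F -> gain Th p x.
Proof.
by move=> xs nps; exists s => //; rewrite !mem_cat (map_f somebox (mem_sublists _ _)) !orbT.
Qed.

(** A critical world is replaced by a Löb-minimal successor of the same [Phi]-type, which has a new
    box. *)
Lemma needs0_CL : ~~ m -> needs0.
Proof.
move=> nm p a b Pab nab; have [Pa Pb] := closedR cPhi Pab.
pose G := [set y : mcs L | lt0 p y /\ exists v : mcs L, crit p b v /\ agree Phi v y].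
have Gmin v : crit p b v -> exists y : mcs L, G y /\ agree Phi v y.
  move=> cv; have [c cT vc] := type_exists nL Phi v.
  have [y [py yc yN]] := loeb_world nL (crit_prec nL cv) vc.
  have vy : agree Phi v y := type_agree nL cT vc yc.
  exists y; split=> //; split; last by exists v.
  exact: (lt0_prec py (types_gain cT py yc yN)).
have [v [cv va]] := crit_exists nL nab; have [x [Gx vx]] := Gmin v cv.
exists G, x; split=> //; last 2 first.
- by apply/vx.
- move=> y [_ [u [cu uy]]] /(uy _ Pb); exact: crit_self cu.
split=> //; first by move=> y [].
move=> c d y Pcd pcd [_ [u [cu uy]]] yc; have [Pc Pd] := closedR cPhi Pcd.
have [z [cz zd]] := crit_exists nL (crit_jump nL pcd cu ((uy _ Pc).2 yc)).
have [z' [Gz' zz']] := Gmin z cz.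
by exists z'; split=> //; [apply/zz'|rewrite (negbTE nm)].
Qed.

End CLSystems.

(** * Critical labels for CLM *)

Section CLMNeeds.

Notation W := (mcs CLM).
Hypothesis nL : normal CLM.
Hypothesis LM : CLM axM.
Variable Phi : seq formula.
Hypothesis cPhi : sub_closed Phi.

Let reach (p : W) b (v : W) : pred formula :=
  fun c => `[< exists v' : W, [/\ crit p b v', incl v v' & v' c] >].

(** The list of reachable types shrinks as [v] gains boxes. *)
Let o (p : W) b (v : W) := somebox [seq c <- types Phi | reach p b v c].

(* Were every successor of [p] with the type [c] of [v] and the boxes of [v] to see [c] at
   depth two, Loeb's axiom would exclude such successors. *)
Lemma type_twin (p v : W) b : crit p b v ->
  exists y : W, [/\ prec p y, agree Phi v y, incl v y & y (□ o p b v)%F].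
Proof.
move=> cv; have [c cT vc] := type_exists nL Phi v.
pose Ps := [set (c && (□ g && □ □ ~~ c))%F | g in [set g | v (□ g)%F]].
have vT : v (□ ⊤)%F by apply: (wNec nL); apply: (taut nL).
have pv := crit_prec nL cv.
have [||_ [g vg <-] /(rhd_bot nL)/(boxP nL) h|y [/(crit_bot nL) py hy]] :=
  @crit_extend _ nL p ⊥%F Ps.
- by exists (c && (□ ⊤ && □ □ ~~ c))%F, ⊤%F.
- move=> _ _ [g vg <-] [g' vg' <-]; exists (c && (□ (g && g') && □ □ ~~ c))%F; split.
  + by exists (g && g')%F => //=; apply: box_and.
  + apply: (worldsP nL) => y; apply/(wImp nL) => /(wAnd nL)[yc /(wAnd nL)[yg yN]].
    apply/(wAnd nL); split=> //; apply/(wAnd nL); split=> //.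
    by apply: (box_mono nL _ yg) => z /(wAnd nL)[].
  + apply: (worldsP nL) => y; apply/(wImp nL) => /(wAnd nL)[yc /(wAnd nL)[yg yN]].
    apply/(wAnd nL); split=> //; apply/(wAnd nL); split=> //.
    by apply: (box_mono nL _ yg) => z /(wAnd nL)[].
- have [|z [pz /(wAnd nL)[zc zg] zN]] := @loeb_world _ nL p v (c && □ g)%F pv.
    exact/(wAnd nL).
  have /(wNot nL) := h z pz; apply; apply/(wAnd nL); split=> //; apply/(wAnd nL); split=> //.
  apply/(boxP nL) => u zu; apply/(boxP nL) => u' uu'; apply/(wNot nL) => u'c.
  have zu' := prec_trans nL zu uu'.
  have /(wNot nL) := zu' _ zN; apply; apply/(wAnd nL); split=> //.
  exact: (prec_incl nL zu').
have yP g : v (□ g)%F -> [/\ y c, y (□ g)%F & y (□ □ ~~ c)%F].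
  by move=> vg; have /(wAnd nL)[? /(wAnd nL)[? ?]] := hy _ (ex_intro2 _ _ g vg erefl).
exists y; split=> //.
- by apply: (type_agree nL cT vc); case: (yP _ vT).
- by move=> g /yP[].
have [_ _] := yP _ vT; apply: (box_mono nL) => z zN; apply/(someboxP nL); exists c => //.
by rewrite mem_filter cT andbT; apply/asboolP; exists v; split.
Qed.

Lemma needs0_CLM : needs0 CLM Phi true.
Proof.
move=> p a b Pab nab; have [Pa Pb] := closedR cPhi Pab.
(* A twin has the type of [v] and exactly the boxes that follow from those of [v] and [□ o]. *)
pose twin (v x : W) := agree Phi x v /\
  forall f, x (□ f)%F <-> forall z : W, prec v z -> z (o p b v) -> z f.
have twinE v : crit p b v -> exists x, twin v x.
  move=> cv; have [y [py vy ivy yo]] := type_twin cv.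
  have oi (x z : W) : incl x z -> x (o p b v) -> z (o p b v) by apply: somebox_incl.
  exists (vroot nL LM ivy yo oi); split; first exact: vroot_agree.
  by move=> f; apply: vroot_box.
pose G := [set x : W | exists2 v, crit p b v & twin v x].
have twin_incl v x : crit p b v -> twin v x -> incl v x.
  by move=> cv [_ tb] f vf; apply/tb => z vz _; apply: vz.
have [v [cv va]] := crit_exists nL nab; have [x [xv xb]] := twinE v cv.
exists G, x; split.
- split=> //= {v cv va x xv xb}.
    move=> x [v cv tx]; have vx := twin_incl _ _ cv tx; have pv := crit_prec nL cv.
    have [xv xb] := tx; have [y [py vy ivy yo]] := type_twin cv.
    split; first exact: incl_trans (prec_incl nL pv) vx.
      exists y; split=> //; first by move=> f Pf; rewrite (xv _ Pf); apply: vy.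
      move=> f /xb xf; apply/(boxP nL) => z yz; apply: xf; first exact: incl_prec ivy yz.
      exact: yz.
    (* The new box is [□ o], unless [p] has it. Then [v] satisfies [o], so some [□ ~~ c] is in [v]
       and in [x], but not in [p], which has a critical successor with [c]. *)
    have xo : x (□ o p b v)%F by apply/xb.
    have [/pv/(someboxP nL)[c]|] := pselect (p (□ o p b v)%F); last first.
      exact: somebox_gain.
    rewrite mem_filter => /andP[/asboolP[v' [cv' _ v'c]] cT] vN.
    exists (~~ c)%F; first by rewrite !mem_cat (map_f Not cT) !orbT.
    split; first exact: vx.
    by move=> /(crit_prec nL cv')/(wNot nL).
  move=> c d x Pcd pcd [v cv tx] xc; have [Pc Pd] := closedR cPhi Pcd.
  have [xv xb] := tx; have vc := (xv _ Pc).1 xc.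
  have [v' [cv' v'd vv']] := crit_jumpM nL LM pcd cv vc.
  have [x' [x'v' x'b]] := twinE v' cv'; exists x'; split; first by exists v'.
    by apply/(x'v' _ Pd).
  (* Types reachable from [v'] are reachable from [v]; so [o] for [v'] implies [o] for [v], and the
     boxes of [x] are kept. *)
  move=> _ f /xb xf; apply/x'b => z v'z zo; apply: xf; first exact: incl_prec vv' v'z.
  move: zo => /(someboxP nL)[e]; rewrite mem_filter => /andP[/asboolP[u [cu v'u ue]] eT] zN.
  apply/(someboxP nL); exists e => //; rewrite mem_filter eT andbT; apply/asboolP.
  by exists u; split=> //; apply: incl_trans vv' v'u.
- by exists v.
- by apply/(xv _ Pa).
- by move=> y [u cu [yu _]] /(yu _ Pb); apply: crit_self cu.
Qed.

End CLMNeeds.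

(** * Completeness *)

Fixpoint subforms (a : formula) : seq formula :=
  a :: match a with
       | Var _ | Top | Bot => [::]
       | Not b | Box b => subforms b
       | And b c | Or b c | Imp b c | Rhd b c => subforms b ++ subforms c
       end.

Lemma subforms_refl a : a \in subforms a.
Proof. by case: a => *; rewrite inE eqxx. Qed.

Lemma subforms_trans a b c : a \in subforms b -> b \in subforms c -> a \in subforms c.
Proof.
move=> ab; elim: c => /= [n|||d IH|d IHd e IHe|d IHd e IHe|d IHd e IHe|d IH|d IHd e IHe];
  rewrite in_cons => /predU1P[bE|]; try (by move: ab; rewrite bE);
  rewrite ?in_nil// => bc; rewrite in_cons; apply/orP; right.
- exact: IH.
- by move: bc; rewrite !mem_cat => /orP[/IHd->|/IHe->]; rewrite ?orbT.
- by move: bc; rewrite !mem_cat => /orP[/IHd->|/IHe->]; rewrite ?orbT.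
- by move: bc; rewrite !mem_cat => /orP[/IHd->|/IHe->]; rewrite ?orbT.
- exact: IH.
- by move: bc; rewrite !mem_cat => /orP[/IHd->|/IHe->]; rewrite ?orbT.
Qed.

Lemma subforms_closed s : sub_closed (flatten (map subforms s)).
Proof.
have down a b : b \in flatten (map subforms s) -> a \in subforms b ->
    a \in flatten (map subforms s).
  move=> /flattenP[_ /mapP[c cs ->] bc] ab; apply/flattenP; exists (subforms c).
    exact: map_f.
  exact: subforms_trans ab bc.
by split=> [a /down h|a b /down h|a b /down h|a b /down h|a /down h|a b /down h];
  repeat split; apply: h; rewrite /= inE ?mem_cat subforms_refl ?orbT.
Qed.

Lemma mem_subforms s a : a \in s -> a \in flatten (map subforms s).
Proof.
by move=> sa; apply/flattenP; exists (subforms a); [exact: map_f|exact: subforms_refl].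
Qed.

Lemma smallest_closed (A : set formula) : closed_under_rules (smallest closed_under_rules A).
Proof.
split.
- by move=> a b ab aA K KA; case: (KA.1) => mp _ _; apply: mp (ab _ KA) (aA _ KA).
- by move=> a aA K KA; case: (KA.1) => _ nec _; apply: nec (aA _ KA).
- by move=> s a aA K KA; case: (KA.1) => _ _ sb; apply: sb (aA _ KA).
Qed.

Lemma normal_CL : normal CL.
Proof.
have [mp nec sb] := smallest_closed (tautology `|` [set axK; axL; axJ1; axJ2; axJ3; axJ4]).
split=> // a aA; apply: sub_gen_smallest; [by left|by right].
Qed.

Lemma extend_sub K chi : K `<=` extend K chi.
Proof. by move=> a Ka; apply: sub_gen_smallest; left. Qed.

Lemma extend_mem K chi : extend K chi chi.
Proof. by apply: sub_gen_smallest; right. Qed.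

Lemma normal_extend K chi : normal K -> normal (extend K chi).
Proof.
move=> nK; have [mp nec sb] := smallest_closed (K `|` [set chi]).
by split=> // a aA; apply: extend_sub; [apply: (ntaut nK)|apply: (nax nK)].
Qed.

Record frame_for (fl : flags) (F : frame) : Prop := FrameFor {
  for_CL : CL_frame F;
  for_J : fJ fl -> forall y z : F, acc y z -> lnk y z;
  for_M : fM fl -> forall y z u : F, lnk y z -> acc z u -> acc y u;
  for_P : fP fl -> forall x y z : F, acc x y -> lnk y z -> acc x z;
  for_W : fW fl -> exists (mu : F -> nat) (N : nat), [/\ forall x, mu x <= N,
    forall x y, acc x y -> mu x < mu y & forall x y, lnk x y -> mu x <= mu y] }.

Section Completeness.

Variables (L : set formula) (fl : flags).
Hypothesis nL : normal L.
Hypothesis WJ : fW fl -> fJ fl /\ ~~ fM fl.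
Hypothesis PJ : fP fl -> fJ fl /\ ~~ fM fl.
Hypothesis sysL : forall Phi, sub_closed Phi -> system L Phi fl.
Hypothesis validL : forall F, frame_for fl F -> L `<=` valid F.

Lemma wConj (x : mcs L) s : x (conj s) <-> forall b, b \in s -> x b.
Proof.
elim: s => [|c s IH] /=; first by split=> // _; apply: wTop.
rewrite (wAnd nL) IH; split=> [[xc xs] b|h].
  by rewrite inE => /predU1P[->//|]; apply: xs.
by split=> [|b bs]; apply: h; rewrite inE ?eqxx ?bs ?orbT.
Qed.

Lemma weakly_complete s a : ~ L (conj s ==> a)%F ->
  exists (F : frame) (v : nat -> set F) (r : F),
    [/\ frame_for fl F, forall b, b \in s -> sat v r b & ~ sat v r a].
Proof.
move=> nsa; have [x [xs nxa]] : exists x : mcs L, x (conj s) /\ ~ x a.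
  apply: contrapT => nx; apply: nsa; apply: (worldsP nL) => x; apply/(wImp nL) => xs.
  by apply: contrapT => nxa; apply: nx; exists x.
have cPhi := subforms_closed (a :: s).
pose Sy := sysL cPhi; pose r : history_frame Sy := exist (@ok L _ fl Sy) (Root x) I.
exists (history_frame Sy), (@history_val _ _ _ Sy), r; split.
- split; first exact: history_CL.
  + by move=> J y z; apply: history_J.
  + by move=> M y z u; apply: history_M.
  + by move=> P y z u; apply: history_P.
  + exact: history_W.
- move=> b bs; apply/(truth WJ PJ nL cPhi); last exact: (wConj x s).1.
  by apply: mem_subforms; rewrite inE bs orbT.
- move=> /(truth WJ PJ nL cPhi) h; apply/nxa/h.
  by apply: mem_subforms; rewrite inE eqxx.
Qed.

Lemma strongly_complete : topologically_strongly_complete L.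
Proof.
move=> Gamma a ent; apply: contrapT => nder.
(* The indices are the finite lists from [Gamma]; each gets a pointed frame that satisfies the list
   and refutes [a]. *)
pose I := {s : seq formula | `[< List.Forall Gamma s >]}.
pose model := {F : frame & ((nat -> set F) * F)%type}.
pose good (i : I) (M : model) := let: existT F (v, r) := M in
  [/\ frame_for fl F, forall b, b \in sval i -> sat v r b & ~ sat v r a].
have [f fP] : {f : I -> model & forall i, good i (f i)}.
  apply: (@choice _ _ good) => -[s sG]; have /asboolP sG' := sG.
  have [|F [v [r h]]] := @weakly_complete s a; first by move=> h; apply: nder; exists s.
  by exists (existT _ F (v, r)).
pose Fr i := projT1 (f i); pose w i : nat -> set (Fr i) := (projT2 (f i)).1.
pose r i : Fr i := (projT2 (f i)).2.
have goodP i : [/\ frame_for fl (Fr i), forall b, b \in sval i -> sat (w i) (r i) b &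
    ~ sat (w i) (r i) a].
  by have := fP i; rewrite /good /Fr /w /r; case: (f i) => F [].
pose cone (s : seq formula) : set I := [set i | {subset s <= sval i}].
have nil_in : `[< List.Forall Gamma [::] >] by apply/asboolP; constructor.
(* The cones generate a proper filter; for an ultrafilter extending it, each member of [Gamma] holds
   at almost all roots. *)
pose B : set_system I := [set A | exists2 i : I, True & cone (sval i) `<=` A].
have BF : ProperFilter B.
  split; first by move=> [i _ /(_ i)]; apply.
  split.
  - by exists (exist _ [::] nil_in).
  - move=> P Q [[s sG] _ sP] [[t tG] _ tQ].
    have stG : `[< List.Forall Gamma (s ++ t) >].
      by apply/asboolP/List.Forall_app; split; apply/asboolP.
    exists (exist _ (s ++ t) stG) => // i sti; split; [apply: sP|apply: tQ] => b bs;
      by apply: sti; rewrite /= mem_cat bs ?orbT.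
  - by move=> P Q PQ [i _ iP]; exists i => // j /iP/PQ.
have [U [UU BU]] := ultraFilterLemma BF.
have FCL i : CL_frame (Fr i) by case: (goodP i) => -[].
have : U [set i | sat (w i) (r i) a].
  apply: (@bouquet_entails _ Fr r U UU FCL L w Gamma a) => //.
    by move=> i; apply: validL; case: (goodP i).
  move=> b Gb; apply: BU.
  have bG : `[< List.Forall Gamma [:: b] >] by apply/asboolP; repeat constructor.
  exists (exist _ [:: b] bG) => // i bi; case: (goodP i) => _ h _.
  by apply: h; apply: bi; rewrite inE.
by move=> /filter_ex[i]; case: (goodP i).
Qed.

End Completeness.

Theorem theorem4p15 (L : set formula) :
  [set CL; CLM; IL; ILM; ILP; ILW] L -> topologically_strongly_complete L.
Proof.
have nIL : normal IL := normal_extend axJ5 normal_CL.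
have validIL fl F : fJ fl -> frame_for fl F -> IL `<=` valid F.
  move=> J FF; apply: valid_extend; first exact: valid_CL (for_CL FF).
  exact: valid_J5 (for_CL FF) (for_J FF J).
have IL5 : IL axJ5 by exact: extend_mem.
have J5 chi : extend IL chi axJ5 by exact: extend_sub.
case=> [[[[[->|->]|->]|->]|->]|->].
- apply: (@strongly_complete _ (Flags false false false false)) => //.
  + exact: normal_CL.
  + by move=> Phi cPhi; apply: system0 (needs0_CL _ _ _) => //; exact: normal_CL.
  + by move=> F /for_CL; apply: valid_CL.
- have nCLM : normal CLM := normal_extend axM normal_CL.
  have M : CLM axM by exact: extend_mem.
  apply: (@strongly_complete _ (Flags false true false false)) => //.
  + by move=> Phi cPhi; apply: system0 => //; exact: needs0_CLM.
  + move=> F FF; apply: valid_extend; first exact: valid_CL (for_CL FF).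
    exact: valid_M (for_M FF isT).
- apply: (@strongly_complete _ (Flags true false false false)) => //.
  + by move=> Phi; apply: system5 => //; exact: extend_mem.
  + by move=> F; apply: validIL.
- apply: (@strongly_complete _ (Flags true true false false)) => //.
  + exact: normal_extend.
  + by move=> Phi; apply: system5 => //; [exact: normal_extend|exact: J5|move=> _; exact: extend_mem].
  + move=> F FF; apply: valid_extend; first exact: validIL FF.
    exact: valid_M (for_M FF isT).
- apply: (@strongly_complete _ (Flags true false true false)) => //.
  + exact: normal_extend.
  + by move=> Phi; apply: system5 => //; [exact: normal_extend|exact: J5|move=> _; exact: extend_mem].
  + move=> F FF; apply: valid_extend; first exact: validIL FF.
    apply: (valid_P (for_CL FF)) => x x' y z _ x'y yz _; exact: (for_P FF isT) x'y yz.
- apply: (@strongly_complete _ (Flags true false false true)) => //.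
  + exact: normal_extend.
  + by move=> Phi; apply: system5 => //; [exact: normal_extend|exact: J5|move=> _; exact: extend_mem].
  + move=> F FF; apply: valid_extend; first exact: validIL FF.
    exact: valid_W (for_CL FF) (for_J FF isT) (for_W FF isT).
Qed.
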